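(* Let $p_0,\ldots,p_k$ be distinct primes, $n=\prod_{i=0}^k p_i$, $\varphi(n)=\prod_{i=0}^k(p_i-1)$, and let $\Phi_n(z)=\sum_{j=0}^{\varphi(n)}c_jz^j\in\mathbb{Z}[z]$ be the $n$-th cyclotomic polynomial. Let $A\subset\{0,\ldots,\varphi(n)\}$ be nonempty, let $c_A=(c_j:j\in A)\in\mathbb{Z}^A$, and let $d_A=\gcd(c_A)$ if $c_A\neq 0$ and $d_A=0$ if $c_A=0$. Then, for the complex $K_A$ defined in the context, $$\tilde H^i(K_A;\mathbb{Z})\cong\begin{cases}\mathbb{Z} & i=k-1 \text{ and } d_A=0,\\ \mathbb{Z}^{|A|-1}\oplus\mathbb{Z}/d_A\mathbb{Z} & i=k,\\ 0&\text{otherwise,}\end{cases}$$ and $$\tilde H_i(K_A;\mathbb{Z})\cong\begin{cases}\mathbb{Z}/d_A\mathbb{Z} & i=k-1,\\ \mathbb{Z}^{|A|} & i=k\text{ and } d_A=0,\\ \mathbb{Z}^{|A|-1} & i=k \text{ and } d_A\neq 0,\\ 0&\text{otherwise.}\end{cases}$$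
   Context: For $0\le i\le k$ let $G_i=\mathbb{Z}/p_i\mathbb{Z}$, regarded as a $0$-dimensional simplicial complex (discrete vertex set), and let $Y=G_0*\cdots*G_k$ be the simplicial join; each $(g_0,\ldots,g_k)\in G=G_0\times\cdots\times G_k$ corresponds to the $k$-simplex $\{g_0,\ldots,g_k\}$ of $Y$. For $B\subset G$ let $X(B)$ be the subcomplex of $Y$ consisting of the $(k-1)$-skeleton of $Y$ together with the $k$-simplices corresponding to elements of $B$. Let $\theta:\mathbb{Z}/n\mathbb{Z}\to G$ be the isomorphism $\theta(x)=(x \bmod p_0,\ldots,x\bmod p_k)$. Let $A_0=\{\varphi(n)+1,\ldots,n-1\}\subset\mathbb{Z}/n\mathbb{Z}$, and for $A\subset\{0,\ldots,\varphi(n)\}$ (viewed in $\mathbb{Z}/n\mathbb{Z}$) let $K_A=X(\theta(A\cup A_0))$. $\tilde H$ denotes reduced (co)homology. *)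

(* Defs.v *)
From HB Require Import structures.
From mathcomp Require Import all_boot all_order all_algebra all_field.
From mathcomp Require Import boolp.

Set Implicit Arguments.
Unset Strict Implicit.
Unset Printing Implicit Defensive.

Import GRing.Theory.
Local Open Scope ring_scope.

Definition zmod_iso (U V : zmodType) : Prop :=
  exists f : {additive U -> V}, bijective f.

Notation "U ≅ V" := (zmod_iso U V) (at level 70, no associativity).

Definition free_zmod (r : nat) : zmodType := 'rV[int]_r.

(* Z/dZ for every d, including Z/0Z = Z and Z/1Z = 0, which rules out 'Z_d. *)
Definition int_mod (d : nat) : zmodType :=
  Quotient.quot (GRing.ZmodClosed.clone int (dvdz d%:Z) _).

Definition dsum (U V : zmodType) : zmodType := (U * V)%type.

Section HomologyOfPair.
Variables (U V W : zmodType) (f : {additive U -> V}) (g : {additive V -> W}).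

Definition in_kernel : {pred V} := fun x => g x == 0.

Fact in_kernel_zmod_closed : zmod_closed in_kernel.
Proof.
split=> [|x y]; rewrite !unfold_in ?raddf0 //.
by move=> /eqP gx /eqP gy; rewrite raddfB gx gy subr0.
Qed.
HB.instance Definition _ :=
  GRing.isZmodClosed.Build V in_kernel in_kernel_zmod_closed.

Definition kernel : Type := {x : V | x \in in_kernel}.
HB.instance Definition _ := SubChoice.on kernel.
HB.instance Definition _ := [SubChoice_isSubZmodule of kernel by <:].

Definition in_image : {pred kernel} := fun x => `[< exists y : U, f y = val x >].

Fact in_image_zmod_closed : zmod_closed in_image.
Proof.
split=> [|x y]; first by apply/asboolP; exists 0; rewrite !raddf0.
move=> /asboolP [x' fx] /asboolP [y' fy]; apply/asboolP; exists (x' - y').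
by rewrite !raddfB fx fy.
Qed.
HB.instance Definition _ :=
  GRing.isZmodClosed.Build kernel in_image in_image_zmod_closed.

(* Ker g / Im f, for composable f and g with g \o f = 0. *)
Definition ker_mod_im : zmodType :=
  Quotient.quot (GRing.ZmodClosed.clone kernel in_image _).

End HomologyOfPair.

(* The empty set is a face of every complex, of dimension -1. *)
Record complex (V : finType) := Complex {
  faces :> {set {set V}};
  set0_face : set0 \in faces;
  sub_face : forall s t : {set V}, s \subset t -> t \in faces -> s \in faces
}.

Definition dim (V : finType) (s : {set V}) : int := #|s|%:Z - 1.

Section SimplicialHomology.
Variables (V : finType) (K : complex V).

Definition simplex (i : int) : Type := {s : {set V} | (s \in K) && (dim s == i)}.
HB.instance Definition _ i := SubFinite.on (simplex i).

(* Simplices are oriented by the enumeration order of V: [s : t] is (-1)^j if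
   t is obtained by deleting the j-th vertex of s, and 0 if t is not a facet
   of s. *)
Definition incidence (s t : {set V}) : int :=
  \sum_(v in s | t == s :\ v)
    (-1) ^+ #|[set u in s | (enum_rank u < enum_rank v)%N]|.

Definition chain (i : int) : zmodType := {ffun simplex i -> int}.

(* Both maps are only meant for j = i - 1 (all incidence numbers vanish for
   other j); keeping j free avoids casts between degrees i + 1 - 1 and i.
   Dimension -1 is included, so the (co)homology below is reduced. *)
Definition boundary (i j : int) (c : chain i) : chain j :=
  [ffun t => \sum_(s : simplex i) incidence (val s) (val t) * c s].

Definition coboundary (j i : int) (c : chain j) : chain i :=
  [ffun s => \sum_(t : simplex j) incidence (val s) (val t) * c t].

Fact boundary_is_zmod_morphism i j : zmod_morphism (@boundary i j).
Proof.
move=> a b; apply/ffunP => t; rewrite !ffunE -sumrB.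
by apply: eq_bigr => s _; rewrite !ffunE mulrBr.
Qed.
HB.instance Definition _ i j :=
  GRing.isZmodMorphism.Build (chain i) (chain j) (@boundary i j)
    (@boundary_is_zmod_morphism i j).

Fact coboundary_is_zmod_morphism j i : zmod_morphism (@coboundary j i).
Proof.
move=> a b; apply/ffunP => s; rewrite !ffunE -sumrB.
by apply: eq_bigr => t _; rewrite !ffunE mulrBr.
Qed.
HB.instance Definition _ j i :=
  GRing.isZmodMorphism.Build (chain j) (chain i) (@coboundary j i)
    (@coboundary_is_zmod_morphism j i).

Lemma incidence_sq (s u : {set V}) :
  \sum_(t : {set V}) incidence s t * incidence t u = 0.
Proof.
pose sg (r : {set V}) (v : V) : int :=
  (-1) ^+ #|[set x in r | (enum_rank x < enum_rank v)%N]|.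
pose F (v w : V) := if [&& v \in s, w \in s, v != w & u == s :\ v :\ w]
  then sg s v * sg (s :\ v) w else 0.
have -> : \sum_(t : {set V}) incidence s t * incidence t u =
          \sum_v \sum_w F v w.
  under eq_bigr => t _ do rewrite /incidence big_mkcond /= mulr_suml.
  rewrite exchange_big /=; apply: eq_bigr => v _.
  rewrite (bigD1 (s :\ v)) //= [X in _ + X]big1 ?addr0; last first.
    by move=> t /negbTE ->; rewrite andbF mul0r.
  rewrite eqxx andbT; case: ifP => vs; last first.
    by rewrite mul0r big1 // => w _; rewrite /F vs.
  rewrite big_mkcond mulr_sumr; apply: eq_bigr => w _.
  rewrite /F vs !inE /= (eq_sym v) -andbA (andbCA (w \in s)).
  by case: ifP; rewrite ?mulr0.
have FN v w : F v w = - F w v.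
  rewrite /F (eq_sym w) [s :\ w :\ v]setDDl [[set w] :|: _]setUC -setDDl.
  rewrite andbCA; case: ifP => [|_]; last by rewrite oppr0.
  case/and4P => ws vs vw _.
  wlog lt_vw : v w ws vs vw / (enum_rank v < enum_rank w)%N.
    move=> IH; case: (ltngtP (enum_rank v) (enum_rank w)) => [lt|lt|e].
    - exact: IH.
    - by rewrite (IH w v) // ?opprK // eq_sym.
    - by case/eqP: vw; apply: enum_rank_inj; apply: val_inj.
  have -> : sg (s :\ w) v = sg s v.
    rewrite /sg; congr (_ ^+ _); apply: eq_card => x; rewrite !inE.
    have [->|//] := eqVneq x w.
    by rewrite [(enum_rank w < _)%N]ltnNge (ltnW lt_vw) !andbF.
  have -> : sg s w = - sg (s :\ v) w.
    rewrite /sg (cardsD1 v) !inE vs lt_vw /= exprS mulN1r.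
    congr (- (_ ^+ _)); apply: eq_card => x; rewrite !inE.
    by rewrite andbA.
  by rewrite mulNr opprK mulrC.
set S := \sum_v _; have SN : S = - S.
  rewrite {1}/S exchange_big /= -sumrN; apply: eq_bigr => v _.
  by rewrite -sumrN; apply: eq_bigr => w _.
have : S *+ 2 == 0 by rewrite mulr2n {2}SN subrr.
by rewrite Num.Theory.mulrn_eq0 /= => /eqP.
Qed.

Lemma incidence_face (s t : {set V}) :
  incidence s t != 0 -> t \subset s /\ dim t = dim s - 1.
Proof.
have [/existsP [v /andP [vs /eqP ->]] _|] :=
  boolP [exists v, (v \in s) && (t == s :\ v)].
  split; first exact: subD1set.
  by rewrite /dim (cardsD1 v s) vs add1n -addn1 PoszD addrK.
rewrite negb_exists => /forallP h; rewrite /incidence big1 ?eqxx // => v hv.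
by move: (h v); rewrite hv.
Qed.

Lemma incidence_simplex_sq i j l (s : simplex i) (u : simplex l) :
  j = i - 1 ->
  \sum_(t : simplex j) incidence (val s) (val t) * incidence (val t) (val u) = 0.
Proof.
move=> ->; rewrite -[RHS](incidence_sq (val s) (val u)).
rewrite [RHS](bigID (fun t => (t \in K) && (dim t == i - 1))) /=.
rewrite [X in _ = _ + X]big1 ?addr0; last first.
  move=> t; apply: contraNeq; rewrite mulf_eq0 => /norP [/incidence_face].
  case: (valP s) => /= /andP [sK /eqP ds] [ts dt] _.
  by rewrite (sub_face ts sK) dt ds eqxx.
rewrite (reindex_omap (val : simplex (i - 1) -> {set V}) insub); last first.
  by move=> t tP; rewrite insubT.
by apply: eq_bigl => t; rewrite valK (valP t) eqxx.
Qed.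

Lemma boundary_boundary (i : int) (c : chain (i + 1)) :
  boundary (i - 1) (boundary i c) = 0.
Proof.
apply/ffunP => u; rewrite !ffunE.
under eq_bigr => t _ do rewrite ffunE mulr_sumr.
rewrite exchange_big big1 // => s _ /=.
under eq_bigr => t _ do rewrite mulrA [incidence (val t) _ * _]mulrC.
by rewrite -mulr_suml incidence_simplex_sq ?addrK ?mul0r.
Qed.

Lemma coboundary_coboundary (i : int) (c : chain (i - 1)) :
  coboundary (i + 1) (coboundary i c) = 0.
Proof.
apply/ffunP => s; rewrite !ffunE.
under eq_bigr => t _ do rewrite ffunE mulr_sumr.
rewrite exchange_big big1 // => u _ /=.
under eq_bigr => t _ do rewrite mulrA.
by rewrite -mulr_suml incidence_simplex_sq ?addrK ?mul0r.
Qed.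

Definition reduced_homology (i : int) : zmodType :=
  ker_mod_im (@boundary (i + 1) i) (@boundary i (i - 1)).

Definition reduced_cohomology (i : int) : zmodType :=
  ker_mod_im (@coboundary (i - 1) i) (@coboundary i (i + 1)).

End SimplicialHomology.

Section Constructions.

Fact discrete_set0 (V : finType) : set0 \in [set s : {set V} | (#|s| <= 1)%N].
Proof. by rewrite inE cards0. Qed.

Fact discrete_sub (V : finType) (s t : {set V}) : s \subset t ->
  t \in [set s : {set V} | (#|s| <= 1)%N] ->
  s \in [set s : {set V} | (#|s| <= 1)%N].
Proof. by move=> /subset_leq_card st; rewrite !inE; apply: leq_trans. Qed.

Definition discrete (V : finType) : complex V :=
  Complex (discrete_set0 V) (@discrete_sub V).

Variables (I : finType) (V : I -> finType).

Definition slice (s : {set {i : I & V i}}) (i : I) : {set V i} :=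
  [set v | Tagged V v \in s].

Variable K : forall i, complex (V i).

Definition join_faces : {set {set {i : I & V i}}} :=
  [set s | [forall i, slice s i \in K i]].

Fact join_set0 : set0 \in join_faces.
Proof.
rewrite inE; apply/forallP => i; apply: sub_face (set0_face (K i)).
by apply/subsetP => v; rewrite !inE.
Qed.

Fact join_sub (s t : {set {i : I & V i}}) :
  s \subset t -> t \in join_faces -> s \in join_faces.
Proof.
move=> /subsetP st; rewrite !inE => /forallP tK; apply/forallP => i.
by apply: sub_face (tK i); apply/subsetP => v; rewrite !inE; apply: st.
Qed.

Definition join : complex {i : I & V i} := Complex join_set0 join_sub.

End Constructions.

Definition skeleton (V : finType) (K : complex V) (m : int) : {set {set V}} :=
  [set s in K | (dim s <= m)%R].

Section CyclotomicComplex.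
Variables (k : nat) (p : 'I_k.+1 -> nat).

(* 'Z_q is Z/qZ only for q > 1; p takes prime values in all uses. *)
Definition vertex : finType := {i : 'I_k.+1 & 'Z_(p i)}.

Definition complexY : complex vertex := join (fun i => discrete 'Z_(p i)).

Definition groupG : finType := {dffun forall i : 'I_k.+1, 'Z_(p i)}.

Definition simplex_of (g : groupG) : {set vertex} :=
  [set Tagged (fun i => 'Z_(p i)) (g i) | i : 'I_k.+1].

Lemma simplex_of_face (g : groupG) : simplex_of g \in complexY.
Proof.
rewrite inE; apply/forallP => i; rewrite inE.
suff /subset_leq_card : slice (simplex_of g) i \subset [set g i].
  by rewrite cards1.
apply/subsetP => v; rewrite !inE => /imsetP [j _ e].
have ij : i = j by exact: (congr1 (@tag _ _) e).
by case: _ / ij e => /eqP; rewrite eq_Tagged.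
Qed.

Definition X_faces (B : {set groupG}) : {set {set vertex}} :=
  skeleton complexY (k%:Z - 1) :|: [set simplex_of g | g in B].

Lemma mem_skeleton_k (s : {set vertex}) :
  (s \in skeleton complexY (k%:Z - 1)) = (s \in complexY) && (#|s| <= k)%N.
Proof. by rewrite in_set /dim Num.Theory.lerD2r. Qed.

Fact X_set0 (B : {set groupG}) : set0 \in X_faces B.
Proof. by rewrite in_setU mem_skeleton_k set0_face cards0. Qed.

Fact X_sub (B : {set groupG}) (s t : {set vertex}) :
  s \subset t -> t \in X_faces B -> s \in X_faces B.
Proof.
move=> st; rewrite !in_setU !mem_skeleton_k => /orP [/andP [tY tk]|].
  by rewrite (sub_face st tY) (leq_trans (subset_leq_card st)).
move=> /imsetP [g gB tg]; rewrite tg in st.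
rewrite (sub_face st (simplex_of_face g)) /=.
case: leqP => //= sk; apply/imsetP; exists g => //; apply/eqP.
rewrite eqEcard st (leq_trans _ sk) // (leq_trans (leq_imset_card _ _)) //.
by rewrite card_ord.
Qed.

Definition complexX (B : {set groupG}) : complex vertex :=
  Complex (X_set0 B) (@X_sub B).

Definition prodp : nat := (\prod_i p i)%N.
Definition phip : nat := (\prod_i (p i).-1)%N.

Definition theta (x : 'Z_prodp) : groupG := [ffun i => inZp x].

Definition setA0 : {set 'Z_prodp} := [set x : 'Z_prodp | (phip < x)%N].

Definition complexK (A : {set 'I_phip.+1}) : complex vertex :=
  complexX (theta @: ([set inZp (val j) | j in A] :|: setA0)).

(* This is 0 when all the coefficients are 0. *)
Definition gcd_coefs (A : {set 'I_phip.+1}) : nat :=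
  \big[gcdn/0%N]_(j in A) absz ('Phi_prodp)`_j.

End CyclotomicComplex.

(* Main.v *)
(* Y is acyclic below its top degree k: chains are pushed, one factor G_i after the
   other, away from the faces missing G_i, by coning with the base vertex 0 of G_i.
   So everything is governed by the group B^k(Y) of top coboundaries, viewed in
   Z[z]/(z^n - 1) by the Chinese remainder theorem.  A coboundary is a sum of
   functions independent of one coordinate, i.e. of multiples of
   (z^n - 1)/(z^(n/p_i) - 1), hence a multiple of Phi_n.  Conversely the same
   homotopy reduces any cochain modulo B^k(Y) to one supported on the exponents
   prime to n; there are phi(n) of them and they span Z[z]/(Phi_n), which is free
   of rank phi(n), so they are independent and B^k(Y) is exactly the ideal (Phi_n).

   Since Phi_n is monic of degree phi(n), the multiples z^j Phi_n with j > 0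
   eliminate the exponents in A_0, and what is left is the single relation c_A on
   Z^A: H^k(K_A) = Z^A / (c_A), H_k(K_A) = the orthogonal of c_A, H_(k-1)(K_A) =
   Z / (c_A), and H^(k-1)(K_A) = {t in Z | t c_A = 0}. *)
Require Import Defs.
From HB Require Import structures.
From mathcomp Require Import all_boot all_order all_algebra all_field.
From mathcomp Require Import boolp ring zify.

Set Implicit Arguments.
Unset Strict Implicit.
Unset Printing Implicit Defensive.

Import GRing.Theory.
Local Open Scope ring_scope.

Local Notation dim := Defs.dim.

(** * Recognising the quotient of a kernel by an image *)

Section KerModIm.
Variables (U V W S T : zmodType) (f : {additive U -> V}) (g : {additive V -> W}).
Variables (psi : S -> V) (rho : S -> T).
Hypotheses (psiB : zmod_morphism psi) (rhoB : zmod_morphism rho).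

Lemma pi_ker_mod_im_eq (x y : kernel g) :
  reflect (exists u, f u = val x - val y)
    (\pi_(ker_mod_im f g)%qT x == \pi_(ker_mod_im f g)%qT y).
Proof. by rewrite -Quotient.idealrBE; apply/asboolP. Qed.

(* T is read off a correspondence V <- S -> T rather than a map from ker g, because
   in degree k - 1 the class of a cycle is only visible on a bounding chain in Y. *)
Lemma ker_mod_im_iso :
  (forall x, g (psi x) = 0) -> (forall t, exists x, rho x = t) ->
  (forall v, g v = 0 -> exists x u, v = psi x + f u) ->
  (forall x, rho x = 0 <-> exists u, f u = psi x) ->
  ker_mod_im f g ≅ T.
Proof.
move=> gpsi rho_surj psi_surj rho0.
have subBB (a b r t : V) : a - r - (b - t) = a - b - (r - t).
  by rewrite opprD addrACA -opprD.
have subKK (a b : V) : a - (a - b) = b by rewrite opprB addrC subrK.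
have rhoE x y : (exists u, f u = psi x - psi y) <-> rho x = rho y.
  rewrite -psiB -rho0 rhoB; split=> [/eqP|->]; last exact: subrr.
  by rewrite subr_eq0 => /eqP.
(* Every class has a correspondent in [S]: some [psi x] differs from its representative by an
   element of the image. *)
have lift (q : ker_mod_im f g) : exists x, exists u, f u = psi x - val (repr q).
  have /eqP gq : g (val (repr q)) == 0 by have := valP (repr q).
  have [x [u ->]] := psi_surj _ gq; exists x, (- u).
  by rewrite raddfN opprD addNKr.
have [F FP] := choice lift.
(* The value of [rho] is the same for all correspondents of [q], so [h] below is independent of the
   choice [F], and this also makes it additive. *)
have FE q x : (exists u, f u = psi x - val (repr q)) -> rho (F q) = rho x.
  move=> [u fu]; apply/rhoE; have [v fv] := FP q; exists (v - u).
  by rewrite raddfB fu fv opprB addrA subrK.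
pose h q := rho (F q).
have hB : zmod_morphism h.
  move=> q1 q2; rewrite /h -rhoB; apply: FE.
  have [u1 f1] := FP q1; have [u2 f2] := FP q2.
  have /pi_ker_mod_im_eq [u fu] : \pi_(ker_mod_im f g)%qT (repr q1 - repr q2) ==
    \pi_(ker_mod_im f g)%qT (repr (q1 - q2)).
    by rewrite reprK raddfB /= !reprK.
  exists (u1 - u2 + u); rewrite raddfD raddfB f1 f2 fu psiB [val (_ - _)]raddfB.
  by rewrite subBB addrA subrK.
pose hA := GRing.isZmodMorphism.Build _ _ h hB.
pose h' : {additive ker_mod_im f g -> T} := HB.pack h hA.
exists h'.
have inj_h : injective h.
  move=> q1 q2 /rhoE [u fu]; rewrite -[q1]reprK -[q2]reprK; apply/eqP.
  apply/pi_ker_mod_im_eq.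
  have [u1 f1] := FP q1; have [u2 f2] := FP q2.
  exists (u - (u1 - u2)).
  by rewrite raddfB (raddfB f u1) fu f1 f2 subBB !subKK.
have surj_h t : exists q, h q = t.
  have [x <-] := rho_surj t.
  have kx : psi x \in in_kernel g by apply/eqP; exact: gpsi.
  pose kx' : kernel g := Sub (psi x) kx.
  exists (\pi_(ker_mod_im f g)%qT kx'); apply: FE.
  have /pi_ker_mod_im_eq [u fu] :
      \pi_(ker_mod_im f g)%qT kx' ==
      \pi_(ker_mod_im f g)%qT (repr (\pi_(ker_mod_im f g)%qT kx')).
    by rewrite reprK.
  by exists u; rewrite fu.
have [h1 h1P] := choice surj_h.
by exists h1 => // q; apply: inj_h; rewrite h1P.
Qed.

End KerModIm.

Lemma ker_mod_im_eq0 (U V W : zmodType) (f : {additive U -> V})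
    (g : {additive V -> W}) :
  (forall v, g v = 0 -> exists u, f u = v) -> ker_mod_im f g ≅ free_zmod 0.
Proof.
move=> ex; apply: (@ker_mod_im_iso _ _ _ int _ _ _ (fun=> 0) (fun=> 0)).
- by move=> x y; rewrite subrr.
- by move=> x y; rewrite subrr.
- by move=> _; rewrite raddf0.
- by move=> t; exists 0; apply/rowP; case.
- by move=> v /ex [u <-]; exists 0, u; rewrite add0r.
- by move=> _; split=> // _; exists 0; rewrite raddf0.
Qed.

(** * Chains extended by zero to all vertex sets *)

Section Chains.
Variables (V : finType) (K : complex V).

(** Chains become functions on all sets of vertices, so that [K] can be compared with a larger
    complex and degrees can be changed without casts. *)
Definition ext i (c : chain K i) (s : {set V}) : int := oapp c 0 (insub s).
Definition res i (c : {set V} -> int) : chain K i := [ffun s => c (val s)].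

Lemma ext_val i (c : chain K i) s : ext c (val s) = c s.
Proof. by rewrite /ext valK. Qed.

Lemma ext_out i (c : chain K i) s : ~~ ((s \in K) && (dim s == i)) -> ext c s = 0.
Proof. by move=> h; rewrite /ext insubN. Qed.

Lemma ext_res i c s : (s \in K) && (dim s == i) -> ext (res i c) s = c s.
Proof. by move=> h; rewrite /ext insubT /= ffunE. Qed.

Lemma sum_ext i (c : chain K i) F :
  \sum_(s : simplex K i) F (val s) * c s = \sum_s F s * ext c s.
Proof.
rewrite [RHS](bigID (fun t => (t \in K) && (dim t == i))) /=.
rewrite [X in _ = _ + X]big1 ?addr0; last by move=> t /ext_out ->; rewrite mulr0.
rewrite (reindex_omap (val : simplex K i -> {set V}) insub); last first.
  by move=> t tP; rewrite insubT.
apply: eq_big => [t|t _]; first by rewrite valK (valP t) eqxx.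
by rewrite ext_val.
Qed.

(** [bd] and [cobd] are the operators of the full simplex on [V], in all degrees at once. *)
Definition bd (c : {set V} -> int) t := \sum_s incidence s t * c s.
Definition cobd (c : {set V} -> int) s := \sum_t incidence s t * c t.

Lemma boundaryE i j (c : chain K i) t : boundary j c t = bd (ext c) (val t).
Proof. by rewrite ffunE (sum_ext c (fun s => incidence s (val t))). Qed.

Lemma coboundaryE i j (c : chain K i) s : coboundary j c s = cobd (ext c) (val s).
Proof. by rewrite ffunE (sum_ext c (fun t => incidence (val s) t)). Qed.

Lemma incidence_neq0 (s t : {set V}) : incidence s t != 0 ->
  exists2 v, v \in s & t = s :\ v.
Proof.
move=> h; have [/existsP [v /andP [vs /eqP e]]|] :=
  boolP [exists v, (v \in s) && (t == s :\ v)]; first by exists v.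
rewrite negb_exists => /forallP n; case/negP: h; rewrite /incidence big1 // => v hv.
by move: (n v); rewrite hv.
Qed.

Lemma bd_ext_out i (c : chain K i) t :
  ~~ ((t \in K) && (dim t == i - 1)) -> bd (ext c) t = 0.
Proof.
move=> tK; rewrite /bd big1 // => s _; apply: contraNeq tK.
rewrite mulf_eq0 => /norP [/incidence_face [ts dt] cs].
have [/andP [sK /eqP ds]|/ext_out e] := boolP ((s \in K) && (dim s == i)).
  by rewrite (sub_face ts sK) dt ds eqxx.
by rewrite e eqxx in cs.
Qed.

Lemma boundary_eq0 i (c : chain K i) :
  boundary (i - 1) c = 0 <-> forall t, bd (ext c) t = 0.
Proof.
split=> [e t|e]; last by apply/ffunP => t; rewrite boundaryE e ffunE.
have [tK|/bd_ext_out //] := boolP ((t \in K) && (dim t == i - 1)).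
have := congr1 (fun f : chain K _ => f (Sub t tK)) e.
by rewrite boundaryE ffunE.
Qed.

Lemma cobd_ext_dim i (c : chain K i) s : dim s != i + 1 -> cobd (ext c) s = 0.
Proof.
move=> ds; rewrite /cobd big1 // => t _; apply: contraNeq ds.
rewrite mulf_eq0 => /norP [/incidence_face [ts dt] cs].
have [/andP [sK /eqP <-]|/ext_out e] := boolP ((t \in K) && (dim t == i)).
  by rewrite dt subrK.
by rewrite e eqxx in cs.
Qed.

(** Unlike boundaries, coboundaries can leave [K]: a cocycle of [K] may have a nonzero [cobd] on
    sets that are not faces of [K], hence the restriction to [s \in K]. *)
Lemma coboundary_eq0 i (c : chain K i) :
  coboundary (i + 1) c = 0 <-> forall s, s \in K -> cobd (ext c) s = 0.
Proof.
split=> [e s sK|e]; last first.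
  apply/ffunP => s; rewrite coboundaryE e ?ffunE //.
  by have /andP [] := valP s.
have [/eqP ds|/cobd_ext_dim //] := boolP (dim s == i + 1).
have sP : (s \in K) && (dim s == i + 1) by rewrite sK ds eqxx.
have := congr1 (fun f : chain K _ => f (Sub s sP)) e.
by rewrite coboundaryE ffunE.
Qed.

Lemma boundary_res i j (b : {set V} -> int) (t : simplex K j) :
  i = j + 1 -> (forall s, dim s = i -> s \notin K -> b s = 0) ->
  boundary j (res i b) t = bd b (val t).
Proof.
move=> -> bK; rewrite boundaryE; apply: eq_bigr => s _.
have [->|/incidence_face [ts dt]] := eqVneq (incidence s (val t)) 0.
  by rewrite !mul0r.
have ds : dim s = j + 1.
  by have /andP [_ /eqP <-] := valP t; rewrite dt subrK.
have [sK|sK] := boolP (s \in K); first by rewrite ext_res // sK ds eqxx.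
by rewrite bK // ext_out // (negPf sK).
Qed.

(** Facets of a face of [K] lie in [K], so in contrast to [boundary_res] nothing is asked of [b]
    outside [K]. *)
Lemma coboundary_res i j (b : {set V} -> int) (s : simplex K j) :
  i = j - 1 -> coboundary j (res i b) s = cobd b (val s).
Proof.
move=> ->; rewrite coboundaryE; apply: eq_bigr => t _.
have [->|/incidence_face [ts dt]] := eqVneq (incidence (val s) t) 0.
  by rewrite !mul0r.
have /andP [sK /eqP ds] := valP s.
by rewrite ext_res // (sub_face ts sK) dt ds eqxx.
Qed.

End Chains.

(** * Incidence numbers *)

Section Incidence.
Variable T : finType.
Implicit Types (s t r : {set T}) (u v w : T).

Definition vertex_sign s v : int :=
  (-1) ^+ #|[set u in s | (enum_rank u < enum_rank v)%N]|.

Lemma incidenceD1 s v : v \in s -> incidence s (s :\ v) = vertex_sign s v.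
Proof.
move=> vs; rewrite /incidence (big_pred1 v) // => u /=; apply/andP/eqP => [|->//].
by move=> [us /eqP/setP /(_ u)]; rewrite !inE eqxx us andbT => /negbFE/eqP.
Qed.

Lemma vertex_signM s v : vertex_sign s v * vertex_sign s v = 1.
Proof. by rewrite -expr2 sqrr_sign. Qed.

Lemma incidenceM s v : v \in s -> incidence s (s :\ v) * incidence s (s :\ v) = 1.
Proof. by move=> vs; rewrite incidenceD1 // vertex_signM. Qed.

Lemma cobdE (c : {set T} -> int) s :
  cobd c s = \sum_(v in s) incidence s (s :\ v) * c (s :\ v).
Proof.
rewrite /cobd; under eq_bigr => t _ do rewrite /incidence mulr_suml.
rewrite (exchange_big_dep (mem s)) //=; last by move=> t v _ /andP [].
apply: eq_bigr => v vs; rewrite (big_pred1 (s :\ v)) ?incidenceD1 // => t.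
by rewrite vs.
Qed.

Lemma bdE (c : {set T} -> int) t :
  bd c t = \sum_(v | v \notin t) incidence (v |: t) t * c (v |: t).
Proof.
rewrite /bd; under eq_bigr => s _ do rewrite /incidence mulr_suml.
rewrite (exchange_big_dep (fun v => v \notin t)) //=; last first.
  by move=> s v _ /andP [vs /eqP ->]; rewrite !inE eqxx.
apply: eq_bigr => v vt; rewrite (big_pred1 (v |: t)).
  by rewrite -[X in incidence _ X](setU1K vt) incidenceD1 // !inE eqxx.
move=> s /=; apply/andP/eqP => [[vs /eqP ->]|->]; first by rewrite setD1K.
by rewrite setU1K // !inE eqxx.
Qed.

(** Exactly two sets lie strictly between [s :\ u :\ v] and [s], so the identity [incidence_sq] has
    only two nonzero terms. *)
Lemma incidence_swap s u v : u \in s -> v \in s -> u != v ->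
  incidence s (s :\ u) * incidence (s :\ u) (s :\ u :\ v) =
  - (incidence s (s :\ v) * incidence (s :\ v) (s :\ u :\ v)).
Proof.
move=> us vs uv; apply/eqP; rewrite -addr_eq0; apply/eqP.
rewrite -[RHS](incidence_sq s (s :\ u :\ v)) (bigD1 (s :\ u)) //=; congr (_ + _).
rewrite (bigD1 (s :\ v)) /=; last first.
  apply/eqP => /setP /(_ u); rewrite !inE eqxx us uv //.
rewrite big1 ?addr0 // => t /andP [tu tv]; apply/eqP; rewrite mulf_eq0 orbC.
have [//|/incidence_neq0 [b bt e]] := eqVneq (incidence t _) 0.
have [//|/incidence_neq0 [a as_ et]] := eqVneq (incidence s t) 0.
move: tu tv bt; rewrite et => au av; rewrite !inE => /andP [ba bs].
have /setP /(_ a) := e; rewrite et !inE eqxx as_ /= andbF andbT.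
have -> : a != u by apply: contraNneq au => ->.
by rewrite andbT => /negbT/negPn/eqP a_v; rewrite a_v eqxx in av.
Qed.

Lemma cobd_cobd (c : {set T} -> int) s : cobd (cobd c) s = 0.
Proof.
rewrite /cobd; under eq_bigr => t _ do rewrite mulr_sumr.
rewrite exchange_big big1 // => u _ /=.
under eq_bigr => t _ do rewrite mulrA.
by rewrite -mulr_suml incidence_sq mul0r.
Qed.

Lemma bd_bd (c : {set T} -> int) s : bd (bd c) s = 0.
Proof.
rewrite /bd; under eq_bigr => t _ do rewrite mulr_sumr.
rewrite exchange_big big1 // => u _ /=.
under eq_bigr => t _ do rewrite mulrA [incidence t s * _]mulrC.
by rewrite -mulr_suml incidence_sq mul0r.
Qed.

Lemma bdB (b c : {set T} -> int) t : bd (fun s => b s - c s) t = bd b t - bd c t.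
Proof. by rewrite /bd -sumrB; apply: eq_bigr => s _; rewrite mulrBr. Qed.

Lemma cobdB (b c : {set T} -> int) t :
  cobd (fun s => b s - c s) t = cobd b t - cobd c t.
Proof. by rewrite /cobd -sumrB; apply: eq_bigr => s _; rewrite mulrBr. Qed.

Lemma bdD (b c : {set T} -> int) t : bd (fun s => b s + c s) t = bd b t + bd c t.
Proof. by rewrite /bd -big_split; apply: eq_bigr => s _; rewrite mulrDr. Qed.

Lemma cobdD (b c : {set T} -> int) t :
  cobd (fun s => b s + c s) t = cobd b t + cobd c t.
Proof. by rewrite /cobd -big_split; apply: eq_bigr => s _; rewrite mulrDr. Qed.

End Incidence.

(** * Acyclicity of a join of discrete sets below the top degree *)

(* Faces are the sets meeting each fibre of [tg] at most once; [w i] is the cone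
   point of the fibre over [i]. *)
Section JoinOfDiscrete.
Variables (T I : finType) (tg : T -> I) (w : I -> T) (Y : {set {set T}}).
Hypothesis tgw : forall i, tg (w i) = i.
Hypothesis YP : forall s : {set T}, reflect {in s &, injective tg} (s \in Y).
Implicit Types (s t r : {set T}) (u v : T) (c b : {set T} -> int).

Lemma join_face_sub s t : s \subset t -> t \in Y -> s \in Y.
Proof.
by move=> /subsetP st /YP tY; apply/YP => u v /st us /st vs; apply: tY.
Qed.

Lemma join_faceU1 s v : s \in Y -> (forall u, u \in s -> tg u != tg v) ->
  v |: s \in Y.
Proof.
move=> /YP sY h; apply/YP => x y; rewrite !inE.
case/orP=> [/eqP ->|xs]; case/orP=> [/eqP ->|ys] // e; last exact: sY.
- by have := h _ ys; rewrite e eqxx.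
- by have := h _ xs; rewrite e eqxx.
Qed.

(** Within [Y] these are the faces of the closed star of [w i], that is, those which remain faces
    after adding [w i]. *)
Definition avoids i s := [forall v in s, (tg v == i) ==> (v == w i)].

(** The transpose of coning with [w i] (the operator [cone] below), acting on cochains. *)
Definition contract i c t : int :=
  if (w i \notin t) && (w i |: t \in Y)
  then incidence (w i |: t) t * c (w i |: t) else 0.

Lemma avoidsP i s :
  reflect (forall v, v \in s -> tg v = i -> v = w i) (avoids i s).
Proof.
apply: (iffP forall_inP) => h v vs; last by apply/implyP => /eqP/(h v vs)/eqP.
by move=> tv; have := h v vs; rewrite tv eqxx => /eqP.
Qed.

(** Homotopy formula: on the closed star of [w i], the coboundary of the contraction plus the
    contraction of the coboundary is the identity, and the second term vanishes for a cocycle. *)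
Lemma cobd_contract i c s : (forall r, r \in Y -> cobd c r = 0) -> s \in Y ->
  avoids i s -> cobd (contract i c) s = c s.
Proof.
move=> c0 sY /avoidsP si; have [ws|ws] := boolP (w i \in s).
  rewrite cobdE (bigD1 (w i)) //= big1 ?addr0; last first.
    by move=> v /andP [vs vw]; rewrite /contract !inE eq_sym vw ws /= mulr0.
  by rewrite /contract setD1K // !inE eqxx sY /= mulrA incidenceM // mul1r.
have rY : w i |: s \in Y.
  apply: join_faceU1 => // u us; rewrite tgw; apply/eqP => /(si _ us) e.
  by rewrite -e us in ws.
set r := w i |: s in rY; have wr : w i \in r by rewrite !inE eqxx.
have rw : r :\ w i = s by rewrite setU1K.
(* The cocycle equation at [r] expresses [c s] through the values at [r :\ v] for [v] in [s];
   [incidence_swap] matches these with the terms of the left-hand side. *)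
have := c0 r rY; rewrite cobdE (bigD1 (w i)) //= rw => /eqP.
rewrite addr_eq0 => /eqP e1.
have := incidenceM wr; rewrite rw => e2.
rewrite -[RHS]mul1r -e2 -mulrA e1 mulrN mulr_sumr -sumrN cobdE.
apply: eq_big => [v|v vs].
  by rewrite !inE; have [->|] := eqVneq v (w i); rewrite ?(negPf ws) ?andbT.
have vw : v != w i by apply: contraNneq ws => <-.
have vr : v \in r by rewrite !inE vs orbT.
have eq_r : w i |: s :\ v = r :\ v.
  by apply/setP => x; rewrite !inE; have [->|] := eqVneq x (w i); rewrite // eq_sym vw.
rewrite /contract eq_r (join_face_sub (subD1set _ _) rY) !inE (negPf ws) andbF /=.
have := incidence_swap vr wr vw.
have es : r :\ v :\ w i = s :\ v.
  by rewrite -rw; apply/setP => x; rewrite !inE andbCA.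
rewrite es rw => e3.
have := incidenceM (_ : w i \in r :\ v); rewrite es !inE eqxx eq_sym vw => /(_ isT) e4.
transitivity (incidence r s * incidence r s * incidence s (s :\ v) *
  incidence (r :\ v) (s :\ v) * c (r :\ v)); first by rewrite e2 mul1r mulrA.
have e5 : incidence r s * incidence s (s :\ v) * incidence (r :\ v) (s :\ v) =
   - incidence r (r :\ v).
  by apply: oppr_inj; rewrite opprK -mulNr -e3 -mulrA e4 mulr1.
have -> : incidence r (r :\ v) =
  - (incidence r s * incidence s (s :\ v) * incidence (r :\ v) (s :\ v)).
  by rewrite e5 opprK.
ring.
Qed.

(** Adding [w i] to a set that avoids [j] keeps it so, even when i = j; hence correcting along [i]
    leaves the fibres already treated untouched. *)
Lemma cobd_contract_avoids i j c s :
  (forall r, r \in Y -> avoids j r -> c r = 0) ->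
  avoids j s -> cobd (contract i c) s = 0.
Proof.
move=> cj /avoidsP sj; rewrite cobdE big1 // => v vs; rewrite /contract.
case: ifP => [/andP [_ wY]|]; last by rewrite mulr0.
rewrite cj ?mulr0 //; apply/avoidsP => u; rewrite !inE.
case/orP=> [/eqP ->|/andP [_ us]]; last exact: sj.
by rewrite tgw => ->.
Qed.

Lemma cocycle_cobd c : (forall s, s \in Y -> cobd c s = 0) ->
  exists b, forall i s, s \in Y -> avoids i s -> cobd b s = c s.
Proof.
move=> c0.
have [b bP] : exists b, forall i, i \in enum I ->
    forall s, s \in Y -> avoids i s -> c s - cobd b s = 0.
  elim: (enum I) => [|i J [b bP]]; first by exists (fun=> 0).
  (* The defect is again a cocycle and vanishes on the faces treated so far; contracting it along
     [i] repairs fibre [i] and preserves these zeros. *)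
  pose c' s := c s - cobd b s.
  have c'0 r : r \in Y -> cobd c' r = 0 by move=> rY; rewrite cobdB cobd_cobd c0.
  exists (fun s => b s + contract i c' s) => j; rewrite inE.
  have [-> _ s sY si|ji /= jJ s sY sj] := eqVneq j i; rewrite cobdD opprD addrA.
    by rewrite (cobd_contract c'0) // subrr.
  by rewrite (bP j) // (@cobd_contract_avoids i j c') ?subr0 // => r; apply: (bP j).
exists b => i s sY si; apply/eqP; rewrite eq_sym -subr_eq0; apply/eqP.
by apply: (bP i) => //; rewrite mem_enum.
Qed.

Definition misses i t := [forall v in t, tg v != i].

Lemma missesP i t : reflect (forall v, v \in t -> tg v <> i) (misses i t).
Proof. by apply: (iffP forall_inP) => h v /h /eqP. Qed.

Definition cone i c s : int :=
  if (s \in Y) && (w i \in s) then incidence s (s :\ w i) * c (s :\ w i) else 0.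

Lemma bd_out b t : (forall s, s \notin Y -> b s = 0) -> t \notin Y -> bd b t = 0.
Proof.
move=> bY tY; rewrite bdE big1 // => v vt; rewrite bY ?mulr0 //.
by apply: contra tY; apply: join_face_sub; apply: subsetUr.
Qed.

Lemma cone_out i c s : s \notin Y -> cone i c s = 0.
Proof. by rewrite /cone => /negPf ->. Qed.

(** The cone lives on faces containing [w i], and [w i |: t] is the only such coface of [t]. *)
Lemma bd_cone_misses i c t : (forall s, s \notin Y -> c s = 0) ->
  misses i t -> bd (cone i c) t = c t.
Proof.
move=> cY /missesP ti; have [tY|tY] := boolP (t \in Y); last first.
  by rewrite cY // bd_out // => s; apply: cone_out.
have wt : w i \notin t by apply/negP => /ti; rewrite tgw.
rewrite bdE (bigD1 (w i)) //= big1 ?addr0; last first.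
  move=> v /andP [vt vw]; rewrite /cone !inE (negPf wt) orbF eq_sym (negPf vw).
  by rewrite andbF mulr0.
rewrite /cone setU1K // join_faceU1 //; last first.
  by move=> u us; rewrite tgw; apply/eqP; apply: ti.
have wr : w i \in w i |: t by rewrite !inE eqxx.
by rewrite wr mulrA -{2 4}(setU1K wt) incidenceM ?mul1r.
Qed.

(** Each term at [t] either involves [c] on a face missing [j], where it vanishes, or belongs to a
    multiple of the cycle equation of [c] at [t :\ w i]. *)
Lemma bd_cone_misses_other i j c t : (forall s, bd c s = 0) ->
  (forall s, misses j s -> c s = 0) -> misses j t -> bd (cone i c) t = 0.
Proof.
move=> c0 cj tj.
have [tY|tY] := boolP (t \in Y); last by rewrite bd_out // => s; apply: cone_out.
have [wt|wt] := boolP (w i \in t); last first.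
  rewrite bdE big1 // => v vt; rewrite /cone !inE (negPf wt) orbF.
  have [->|] := eqVneq (w i) v; rewrite ?andbF ?mulr0 //.
  by rewrite setU1K // cj // mulr0 if_same mulr0.
have ij : i != j by apply/eqP => ij; have /missesP/(_ _ wt) := tj; rewrite tgw.
have := c0 (t :\ w i); rewrite bdE (bigD1 (w i)) ?inE ?eqxx //=.
rewrite setD1K // (cj t) // mulr0 add0r => e1.
rewrite -[RHS](mulr0 (- incidence t (t :\ w i))) -e1 mulr_sumr bdE.
apply: eq_big => [v|v vt].
  by rewrite !inE negb_and negbK; have [->|] := eqVneq v (w i); rewrite ?wt ?andbT.
have vw : v != w i by apply: contraNneq vt => ->.
set r := v |: t; have rw : v |: (t :\ w i) = r :\ w i.
  apply/setP => x; rewrite !inE.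
  by have [->|] := eqVneq x (w i); rewrite // eq_sym (negPf vw).
rewrite rw; have [rj|] := boolP (misses j (r :\ w i)).
  by rewrite /cone cj // !mulr0 if_same mulr0.
case/forall_inPn => x; rewrite !inE negbK => /andP [xw xr] /eqP xj.
have {xr} xv : x = v.
  by case/orP: xr => [/eqP //|xt]; have /missesP/(_ _ xt) := tj; rewrite xj.
rewrite xv {x xw xv} in xj.
(* [v] lies over [j] and the face [t] has no vertex there, so adding [v] gives a face again. *)
have rY : r \in Y.
  apply: join_faceU1 => // u us; rewrite xj; apply/eqP.
  by have /missesP := tj; apply.
have wr : w i \in r by rewrite !inE wt orbT.
have vr : v \in r by rewrite !inE eqxx.
rewrite /cone rY wr /=.
have := incidence_swap vr wr vw; rewrite setU1K // => e3.
have e2 := incidenceM wt.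
have := @incidenceM _ (r :\ w i) v.
have -> : r :\ w i :\ v = t :\ w i.
  by rewrite -[in RHS](setU1K vt); apply/setP => x; rewrite !inE andbCA.
rewrite !inE vw eqxx => /(_ isT) e4.
rewrite !mulrA; congr (_ * _).
have e5 := incidenceM wr.
have e6 : incidence r t = incidence t (t :\ w i) *
    - (incidence r (r :\ w i) * incidence (r :\ w i) (t :\ w i)).
  by rewrite -e3 mulrCA e2 mulr1.
rewrite e6 -[RHS]mul1r -e5; ring.
Qed.

Lemma cycle_bd c : (forall s, s \notin Y -> c s = 0) -> (forall t, bd c t = 0) ->
  exists2 b, forall s, s \notin Y -> b s = 0 &
    forall i t, misses i t -> bd b t = c t.
Proof.
move=> cY c0.
have [b bY bP] : exists2 b, forall s, s \notin Y -> b s = 0 &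
    forall i, i \in enum I -> forall t, misses i t -> c t - bd b t = 0.
  elim: (enum I) => [|i J [b bY bP]]; first by exists (fun=> 0).
  (* As for cochains: the defect is a cycle supported on [Y] and is coned off from one more
     fibre. *)
  pose c' s := c s - bd b s.
  have c'Y s : s \notin Y -> c' s = 0.
    by move=> sY; rewrite /c' cY // bd_out // subrr.
  have c'0 t : bd c' t = 0 by rewrite bdB bd_bd c0 subrr.
  exists (fun s => b s + cone i c' s) => [s sY|j].
    by rewrite bY // cone_out // addr0.
  rewrite inE; have [-> _ t ti|ji /= jJ t tj] := eqVneq j i;
    rewrite bdD opprD addrA.
    by rewrite bd_cone_misses // subrr.
  by rewrite (bP j) // (@bd_cone_misses_other i j c') ?subr0 // => r; apply: (bP j).
exists b => // i t ti; apply/eqP; rewrite eq_sym -subr_eq0; apply/eqP.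
by apply: (bP i) => //; rewrite mem_enum.
Qed.

End JoinOfDiscrete.

(** * Cyclotomic and monic polynomials *)

(** The sum is (X^(pq) - 1)/(X^q - 1), the product of the Phi_d with d dividing pq but not q; as p >
    1, d = pq is one of them. *)
Lemma Cyclotomic_dvd_geometric p q : (1 < p)%N -> (0 < q)%N ->
  exists g, \sum_(a < p) 'X^q ^+ a = 'Phi_(p * q) * g.
Proof.
move=> p1 q0; have n0 : (0 < p * q)%N by rewrite muln_gt0 (ltnW p1).
have nq : (p * q %| q)%N = false.
  by apply/negP => /(dvdn_leq q0); rewrite leqNgt ltn_Pmull.
exists (\prod_(d <- divisors (p * q) | (d != (p * q)%N) && ~~ (d %| q)%N) 'Phi_d).
have Xq0 : 'X^q - 1 != 0 :> {poly int} by rewrite monic_neq0 ?monic_Xn_sub_1.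
apply: (mulfI Xq0); rewrite -subrX1 -exprM [(q * p)%N]mulnC -(prod_Cyclotomic n0).
rewrite (bigD1_seq (p * q)%N) ?divisors_uniq //=; last by rewrite -dvdn_divisors.
rewrite mulrCA; congr (_ * _); rewrite (bigID (fun d => (d %| q)%N)) /=.
congr (_ * _); rewrite -(prod_Cyclotomic q0) -big_filter; apply: perm_big.
apply: uniq_perm; rewrite ?filter_uniq ?divisors_uniq // => d.
rewrite mem_filter -!dvdn_divisors //; apply/andP/idP => [[/andP []] //|dq].
split; last exact: dvdn_mull.
by rewrite dq andbT; apply: contraTneq dq => ->; rewrite nq.
Qed.

(** A coefficient sequence of period [q] is one block of length [q] repeated [p] times, and the
    geometric sum does the repetition. *)
Lemma poly_periodic (p q : nat) (F : nat -> int) :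
  \poly_(m < p * q) F (m %% q)%N = (\poly_(r < q) F r) * \sum_(a < p) 'X^q ^+ a.
Proof.
rewrite !poly_def -(big_mkord predT (fun m => F (m %% q)%N *: 'X^m)).
elim: p => [|p IH]; first by rewrite mul0n big_geq // big_ord0 mulr0.
rewrite (@big_cat_nat _ _ _ (p * q)) //=; last by rewrite leq_mul2r leqnSn orbT.
rewrite IH big_ord_recr /= mulrDr; congr (_ + _).
rewrite -{1}[(p * q)%N]add0n big_addn mulSn addnK big_mkord mulr_suml.
apply: eq_bigr => r _; rewrite addnC modnMDl modn_small // exprD mulnC exprM.
by rewrite -scalerAl [in RHS]mulrC.
Qed.

Section Monic.
Variables (phi : nat) (P : {poly int}).
Hypotheses (Pmonic : P \is monic) (sizeP : size P = phi.+1).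

Lemma monic_coef_phi : P`_phi = 1.
Proof. by move/monicP: Pmonic; rewrite lead_coefE sizeP. Qed.

Lemma monic_mul_small g : (size (P * g)%R <= phi)%N -> P * g = 0.
Proof.
have [->|g0] := eqVneq g 0; first by rewrite mulr0.
have := size_monicM Pmonic g0; rewrite sizeP => ->.
by have : size g != 0%N; [rewrite size_poly_eq0 | lia].
Qed.

(* A spanning family of phi elements in the free module Z[X]/(P) of rank phi is
   independent: a square integer matrix with a left inverse is invertible. *)
Lemma monomials_free (e : 'I_phi -> nat) :
  (forall m : 'I_phi, exists x : 'rV[int]_phi,
     exists g, 'X^m = \sum_l x 0 l *: 'X^(e l) + P * g) ->
  forall (x : 'rV[int]_phi) g, \sum_l x 0 l *: 'X^(e l) = P * g -> x = 0.
Proof.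
move=> span.
have modP (f : {poly int}) :
    exists2 r : {poly int}, (size r <= phi)%N & exists g, f = r + P * g.
  exists (f %% P); last first.
    by exists (f %/ P); rewrite mulrC addrC -Pdiv.IdomainMonic.divp_eq.
  by rewrite -ltnS -sizeP ltn_modp monic_neq0.
have modX l : exists r : {poly int},
    (size r <= phi)%N /\ exists g, 'X^(e l) = r + P * g.
  by have [r ? ?] := modP 'X^(e l); exists r.
have [r /all_and2 [sr rP]] := choice modX.
have [h hP] := choice rP.
have combE (x : 'rV[int]_phi) : \sum_l x 0 l *: 'X^(e l) =
    \sum_l x 0 l *: r l + P * \sum_l x 0 l *: h l.
  rewrite mulr_sumr -big_split; apply: eq_bigr => l _ /=.
  by rewrite hP scalerDr scalerAr.
have size_comb (x : 'rV[int]_phi) : (size (\sum_l x 0%R l *: r l)%R <= phi)%N.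
  apply: leq_trans (size_sum _ _ _) _; apply/bigmax_leqP => l _.
  exact: leq_trans (size_scale_leq _ _) (sr l).
(* Row [l] holds the coordinates of X^(e l) modulo [P] in the basis 1, ..., X^(phi-1); the spanning
   hypothesis provides the rows [W m] of a left inverse. *)
pose N := \matrix_(l < phi, m < phi) (r l)`_m.
have [W WP] := choice span.
have coefN (x : 'rV[int]_phi) (m : 'I_phi) :
    (x *m N) 0 m = (\sum_l x 0 l *: r l)`_m.
  by rewrite mxE coef_sum; apply: eq_bigr => l _; rewrite coefZ mxE.
have NW : (\matrix_m W m) *m N = 1%:M.
  apply/row_matrixP => m; rewrite row_mul rowK row1; apply/rowP => m'.
  rewrite coefN mxE /=; have [g] := WP m; rewrite combE -addrA -mulrDr => Xm.
  set g' := _ + g in Xm.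
  have : P * g' = 0.
    apply: monic_mul_small; move/eqP: Xm; rewrite addrC -subr_eq => /eqP <-.
    apply: leq_trans (size_polyD _ _) _; rewrite geq_max size_polyXn ltn_ord.
    by rewrite size_polyN size_comb.
  move=> g'0; rewrite g'0 addr0 in Xm.
  by rewrite -Xm coefXn.
move=> x g; rewrite combE => /eqP; rewrite -subr_eq0 -addrA -mulrBr addr_eq0.
rewrite -mulrN => /eqP xr.
have xr0 : \sum_l x 0 l *: r l = 0.
  by rewrite xr; apply: monic_mul_small; rewrite -xr size_comb.
rewrite -[x]mulmx1 -(mulmx1C NW) mulmxA.
have -> : x *m N = 0 by apply/rowP => m; rewrite coefN xr0 coef0 mxE.
by rewrite mul0mx.
Qed.

(* The pairing of [f] with the coefficients of 'X^j * P. *)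
Definition shift_pairing (f : nat -> int) j : int :=
  \sum_(l < phi.+1) P`_l * f (l + j)%N.

Lemma shift_pairingB f g j :
  shift_pairing (fun m => f m - g m) j = shift_pairing f j - shift_pairing g j.
Proof. by rewrite /shift_pairing -sumrB; apply: eq_bigr => l _; rewrite mulrBr. Qed.

Lemma shift_pairingZ a f j :
  shift_pairing (fun m => a * f m) j = a * shift_pairing f j.
Proof. by rewrite /shift_pairing mulr_sumr; apply: eq_bigr => l _; rewrite mulrCA. Qed.

(** As [P] is monic of degree phi, the equation at [j] determines [f (phi + j)] from earlier values.
    Only j > 0 is imposed, so all values at 0, ..., phi stay free and the equation at 0 is left
    over. *)
Lemma recurrence_extend (a : nat -> int) : exists f : nat -> int,
  (forall m, (m <= phi)%N -> f m = a m) /\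
  forall j, (0 < j)%N -> shift_pairing f j = 0.
Proof.
(* [next j] alters only the value at phi + j + 1, so [g j m] is final once m <= phi + j, and the
   diagonal [g m m] is the limit. *)
pose next (j : nat) (g : nat -> int) m :=
  if m == (phi + j.+1)%N then - \sum_(l < phi) P`_l * g (l + j.+1)%N else g m.
pose g := fix g j := if j is j'.+1 then next j' (g j') else a.
have gS j i m : (m <= phi + j)%N -> g (i + j)%N m = g j m.
  move=> mj; elim: i => //= i <-; rewrite /next .
  by case: eqP => // e; exfalso; lia.
exists (fun m => g m m); split=> [m mp|[//|j] _].
  by rewrite -[in LHS](addn0 m) -[X in g _ X]addn0 gS ?addn0.
have gE l : (l <= phi)%N -> g (l + j.+1)%N (l + j.+1)%N = g j.+1 (l + j.+1)%N.
  by move=> lp; rewrite gS // leq_add2r.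
rewrite /shift_pairing big_ord_recr /= monic_coef_phi mul1r gE // /= /next eqxx.
apply/eqP; rewrite subr_eq0; apply/eqP; apply: eq_bigr => l _; rewrite gE 1?ltnW //.
by rewrite /= /next eqn_add2r ltn_eqF.
Qed.

Lemma recurrence_unique (f : nat -> int) N :
  (forall m, (m <= phi)%N -> f m = 0) ->
  (forall j, (0 < j < N)%N -> shift_pairing f j = 0) ->
  forall m, (m < phi + N)%N -> f m = 0.
Proof.
move=> f0 fN; elim/ltn_ind=> m IH mN; have [/f0 //|pm] := leqP m phi.
have jN : (0 < m - phi < N)%N by lia.
have := fN _ jN; rewrite /shift_pairing big_ord_recr /= monic_coef_phi mul1r.
rewrite subnKC 1?ltnW // big1 ?add0r // => l _; rewrite IH ?mulr0 //.
  by have := ltn_ord l; lia.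
by have := ltn_ord l; lia.
Qed.

(** Multiplication by [P] is the transpose of the shift pairing, as one sees by expanding [q] in
    monomials. *)
Lemma pairing_mul (f : nat -> int) N (q : {poly int}) : (size q <= N)%N ->
  \sum_(m < phi + N) f m * (P * q)`_m = \sum_(j < N) q`_j * shift_pairing f j.
Proof.
move=> sq; rewrite -(coefK q) poly_def.
rewrite (big_ord_widen N (fun i => q`_i *: 'X^i)) // mulr_sumr.
under eq_bigr => m _ do rewrite coef_sum mulr_sumr.
rewrite exchange_big big_mkcond /=; apply: eq_bigr => j _.
have -> : (\sum_(i < N | (i < size q)%N) q`_i *: 'X^i)`_j = q`_j.
  rewrite coef_sum; have [jq|jq] := ltnP j (size q).
    rewrite (bigD1 j) //= big1 ?addr0 ?coefZ ?coefXn ?eqxx ?mulr1 // => i /andP [_ ij].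
    by rewrite -val_eqE in ij; rewrite coefZ coefXn eq_sym (negPf ij) mulr0.
  rewrite [RHS]nth_default // big1 // => i iq; rewrite coefZ coefXn.
  by case: eqP => [e|]; [exfalso; lia | rewrite mulr0].
case: ifP => [_|/negbT]; last first.
  by rewrite -leqNgt => jq; rewrite nth_default // mul0r.
rewrite /shift_pairing mulr_sumr.
pose F m := q`_j * ((if (m < j)%N then 0 else P`_(m - j)) * f m).
transitivity (\sum_(m < phi + N) F m).
  by apply: eq_bigr => m _; rewrite /F -scalerAr coefZ coefMXn; ring.
have jN := ltn_ord j.
rewrite -(big_mkord predT F) /F.
(* Only the exponents from j to j + phi meet the coefficients of X^j P; the two outer ranges
   contribute 0. *)
rewrite (@big_cat_nat _ _ _ j) //=; last by lia.
rewrite big_nat big1 ?add0r; last by move=> m /andP [_ ->]; rewrite mul0r mulr0.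
rewrite (@big_cat_nat _ _ _ (phi.+1 + j)) /=; try lia.
rewrite [X in _ + X]big_nat [X in _ + X]big1 ?addr0; last first.
  move=> m /andP [mj _]; case: ifP => _; rewrite ?mul0r ?mulr0 //.
  have sP : (size P <= m - j)%N by rewrite sizeP; lia.
  by rewrite [P`_(m - j)]nth_default // mul0r mulr0.
rewrite -{1}[j : nat]add0n big_addn addnK big_mkord; apply: eq_bigr => l _.
by rewrite addnK; case: ifP => // h; exfalso; lia.
Qed.

End Monic.

(** Smith form of a one-row matrix: the left factor is a unit, and the single invariant is the gcd
    [d] up to sign. Describing [d] by divisibility covers d = 0 as well. *)
Lemma row_unimodular r (c : 'rV[int]_r.+1) (d : nat) :
  (forall z : int, (forall l, (z %| c ord0 l)%Z) <-> (z %| d%:Z)%Z) ->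
  exists2 U : 'M[int]_r.+1, U \in unitmx & c = d%:Z *: row 0 U.
Proof.
move=> dP; have [L Lu [U Uu [e _ cE]]] := int_Smith_normal_form c.
have [u uu uc] : exists2 u : int, u * u = 1 & c = (u * e`_0) *: row 0 U.
  exists (L 0 0).
    by move: Lu; rewrite unitmxE [L]mx11_scalar det_scalar1 !mxE mulr1n => /mulVr.
  apply/rowP => j; rewrite {1}cE [L]mx11_scalar mul_scalar_mx -scalemxAl !mxE.
  rewrite mulr1n -mulrA; congr (_ * _).
  rewrite (bigD1 0) //= big1 ?addr0 ?mxE ?mulr1n // => i i0.
  by rewrite mxE; move: i0; rewrite eq_sym -val_eqE => /negPf ->; rewrite mul0r.
have zd : ((u * e`_0)%R %| d%:Z)%Z.
  by apply/dP => l; rewrite uc mxE dvdz_mulr.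
have dz : (d%:Z %| (u * e`_0)%R)%Z.
  have : c *m invmx U = (u * e`_0) *: delta_mx 0 0.
    by rewrite uc -scalemxAl -row_mul mulmxV // row1.
  move/rowP/(_ 0); rewrite !mxE eqxx mulr1 => <-.
  by apply: rpred_sum => l _; rewrite dvdz_mulr //; apply/dP: l.
(* Two integers dividing each other differ by a sign, which is then moved into [U]. *)
have [s ss sd] : exists2 s : int, s * s = 1 & u * e`_0 = s * d%:Z.
  case/dvdzP: dz => s sE; case/dvdzP: zd => t; rewrite sE mulrA => tE.
  have [d0|d0] := eqVneq d 0%N; first by exists 1; rewrite ?sE ?d0 ?mulr0 ?mulr1.
  have ts : t * s = 1.
    apply: (@mulIf _ d%:Z); rewrite ?mul1r // eqz_nat //.
  exists s => //; have : s \is a GRing.unit by apply/unitrPr; exists t; rewrite mulrC.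
  by move/mulVr.
exists (s *: U); last by rewrite uc sd linearZ scalerA mulrC.
rewrite unitmxE detZ unitrM -unitmxE Uu andbT unitrX //.
by apply/unitrPr; exists s.
Qed.

(** * Top faces and the cyclotomic ideal *)

(* The enumeration of a sigma type is lexicographic, so the sign of a vertex in a
   top face depends only on its tag. *)
Lemma enum_rank_tag (k : nat) (V : 'I_k -> finType) (u v : {i : 'I_k & V i}) :
  (tag u < tag v)%N -> (enum_rank u < enum_rank v)%N.
Proof.
rewrite !ltnNge; apply: contra; rewrite /enum_rank !enum_rank_in.unlock.
rewrite !insubdK ?unfold_in ?cardE ?index_mem ?mem_enum //.
pose r := relpre (fun u : {i : 'I_k & V i} => nat_of_ord (tag u)) leq.
suff sr : sorted r (enum {: {i : 'I_k & V i}}).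
  apply: (sorted_leq_index (leT := r)) => //; rewrite ?mem_enum //.
  - by move=> x y z; apply: leq_trans.
  - by move=> x; apply: leqnn.
have r_tr : transitive r by move=> x y z; apply: leq_trans.
rewrite sorted_pairwise // enumT unlock /= /tag_enum -enumT.
have : pairwise ltn [seq val i | i <- enum 'I_k].
  by rewrite val_enum_ord -sorted_pairwise ?iota_ltn_sorted //; apply: ltn_trans.
elim: (enum 'I_k) => //= i s IH /andP [/allP is_ ps]; rewrite pairwise_cat IH // andbT.
apply/andP; split.
  apply/allrelP => x y /mapP [a _ ->] /flatten_mapP [j js /mapP [b _ ->]].
  by apply: ltnW; apply: is_; apply: map_f.
rewrite pairwise_map; elim: (Finite.enum (V i)) => //= a e ->; rewrite andbT.
by apply/allP => b _; apply: leqnn.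
Qed.

Section TopFaces.
Variables (k : nat) (p : 'I_k.+1 -> nat).
Hypotheses (p_prime : forall i, prime (p i)) (p_inj : injective p).
Local Notation n := (prodp p).
Local Notation phi := (phip p).
Local Notation Y := (complexY p).
Implicit Types (i j : 'I_k.+1) (m : nat) (y : {set vertex p} -> int).

Lemma coprime_p i j : i != j -> coprime (p i) (p j).
Proof.
by move=> ij; rewrite prime_coprime // dvdn_prime2 // (inj_eq p_inj).
Qed.

Lemma coprime_prodn (r : seq 'I_k.+1) m :
  coprime m (\prod_(i <- r) p i)%N = all (fun i => coprime m (p i)) r.
Proof.
elim: r => [|i r IH]; first by rewrite big_nil coprimen1.
by rewrite big_cons coprimeMr IH.
Qed.

Lemma coprime_p_prod (r : seq 'I_k.+1) i : i \notin r ->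
  coprime (p i) (\prod_(j <- r) p j)%N.
Proof.
move=> ir; rewrite coprime_prodn; apply/allP => j jr; apply: coprime_p.
by apply: contraNneq ir => ->.
Qed.

Lemma dvdn_prod_p (r : seq 'I_k.+1) d : uniq r ->
  {in r, forall i, p i %| d}%N -> (\prod_(i <- r) p i %| d)%N.
Proof.
elim: r => [|i r IH] /=; first by rewrite big_nil dvd1n.
case/andP=> ir ur h; rewrite big_cons Gauss_dvd ?coprime_p_prod // h ?mem_head //=.
by apply: IH => // j jr; apply: h; rewrite inE jr orbT.
Qed.

Lemma p_dvd_prodp i : (p i %| n)%N.
Proof. by rewrite /prodp (bigD1 i) //= dvdn_mulr. Qed.

Lemma prodp_gt0 : (0 < n)%N.
Proof. by apply: prodn_gt0 => i; apply: prime_gt0. Qed.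

Lemma prodp_gt1 : (1 < n)%N.
Proof.
exact: leq_trans (prime_gt1 (p_prime ord0)) (dvdn_leq prodp_gt0 (p_dvd_prodp _)).
Qed.

Lemma eqn_mod_prodp m m' : (forall i, m = m' %[mod p i]) -> m = m' %[mod n].
Proof.
wlog le : m m' / (m <= m')%N => [H h|h].
  by case: (leqP m m') => [/H ->//|/ltnW/H->//].
apply/esym/eqP; rewrite eqn_mod_dvd //; apply: dvdn_prod_p.
  exact: index_enum_uniq.
by move=> i _; rewrite -eqn_mod_dvd //; apply/eqP/esym.
Qed.

Lemma totient_prodp : totient n = phi.
Proof.
rewrite /prodp /phip; elim: (index_enum _) (index_enum_uniq 'I_k.+1) => [|i r IH] /=.
  by rewrite !big_nil.
case/andP=> ir ur; rewrite !big_cons totient_coprime ?coprime_p_prod //.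
by rewrite totient_prime // IH.
Qed.

Lemma phip_lt_prodp : (phi < n)%N.
Proof.
rewrite -totient_prodp totient_count_coprime big_ltn ?prodp_gt0 //.
rewrite /coprime gcdn0 gtn_eqF ?prodp_gt1 // add0n.
apply: (@leq_ltn_trans (\sum_(1 <= i < n) 1)%N); last first.
  by rewrite sum_nat_const_nat muln1 subn1 prednK ?prodp_gt0.
by apply: leq_sum => i _; case: (_ == _).
Qed.

Lemma size_Phi : size 'Phi_n = phi.+1.
Proof. by rewrite size_Cyclotomic totient_prodp. Qed.

(** Vertices and top faces are indexed by natural numbers instead of residues, so that the index can
    serve as an exponent of a polynomial. *)
Definition vtx i m : vertex p := Tagged (fun i => 'Z_(p i)) (inZp m : 'Z_(p i)).
Definition top_face m : {set vertex p} := [set vtx i m | i : 'I_k.+1].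

Lemma simplex_of_theta (x : 'Z_n) : simplex_of (theta x) = top_face x.
Proof. by apply: eq_imset => i; rewrite /theta ffunE. Qed.

Lemma vtx_inj m : injective (vtx^~ m).
Proof. by move=> i j /(congr1 (@tag _ _)). Qed.

Lemma vtx_top i m : vtx i m \in top_face m.
Proof. exact: imset_f. Qed.

Lemma card_top_face m : #|top_face m| = k.+1.
Proof. by rewrite card_imset ?card_ord //; apply: vtx_inj. Qed.

Lemma dim_top_face m : dim (top_face m) = k.
Proof. by rewrite /dim card_top_face; lia. Qed.

Lemma vtx_eq_mod i m m' : m = m' %[mod p i] -> vtx i m = vtx i m'.
Proof.
move=> e; congr (Tagged _ _); apply: val_inj => /=.
by rewrite Zp_cast ?prime_gt1.
Qed.

Lemma vtx_mod_eq i m m' : vtx i m = vtx i m' -> m = m' %[mod p i].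
Proof.
move/eqP; rewrite eq_Tagged /= => /eqP /(congr1 val) /=.
by rewrite Zp_cast ?prime_gt1.
Qed.

Lemma mem_top_face (v : vertex p) m : (v \in top_face m) = (v == vtx (tag v) m).
Proof. by apply/imsetP/eqP => [[i _ ->] //|->]; exists (tag v). Qed.

Lemma top_face_inj m m' : (m < n)%N -> (m' < n)%N -> top_face m = top_face m' -> m = m'.
Proof.
move=> mn mn' e; have : m = m' %[mod n].
  apply: eqn_mod_prodp => i; have := vtx_top i m; rewrite e mem_top_face => /eqP.
  exact: vtx_mod_eq.
by rewrite !modn_small.
Qed.

Lemma complexYP (s : {set vertex p}) :
  reflect {in s &, injective (@tag _ _)} (s \in Y).
Proof.
rewrite inE; apply: (iffP forallP) => h.
  move=> [i x] [j y] xs ys /= ij; case: _ / ij y ys => y ys.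
  have := h i; rewrite inE => /card_le1_eqP e.
  by congr (Tagged _ _); apply: e; rewrite inE.
move=> i; rewrite inE; apply/card_le1_eqP => x y; rewrite !inE => xs ys.
by have := h _ _ xs ys erefl => /eqP; rewrite eq_Tagged => /eqP.
Qed.

Lemma top_face_Y m : top_face m \in Y.
Proof.
apply/complexYP => u v; rewrite !mem_top_face => /eqP eu /eqP ev e.
by rewrite eu e -ev.
Qed.

Lemma card_face (s : {set vertex p}) : s \in Y -> (#|s| <= k.+1)%N.
Proof.
by move=> /complexYP h; rewrite -(card_in_imset h) -[X in (_ <= X)%N]card_ord max_card.
Qed.

Lemma face_is_top (s : {set vertex p}) : s \in Y -> #|s| = k.+1 ->
  exists2 m, (m < n)%N & s = top_face m.
Proof.
move=> sY sk; have /complexYP h := sY.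
have full i : exists x : 'Z_(p i), Tagged (fun i => 'Z_(p i)) x \in s.
  have : i \in [set tag v | v in s].
    suff -> : [set tag v | v in s] = setT by rewrite inE.
    by apply/eqP; rewrite eqEcard subsetT cardsT card_ord card_in_imset ?sk /=.
  by case/imsetP=> [[j x] xs /= ->]; exists x.
pose f (x : 'I_n) : groupG p := [ffun i => inZp x].
have f_inj : injective f.
  move=> x y e; apply: val_inj; apply: (top_face_inj (ltn_ord x) (ltn_ord y)).
  apply: eq_imset => i; rewrite /vtx; congr (Tagged _ _).
  by have := congr1 (fun g : groupG p => g i) e; rewrite !ffunE.
have card_G : #|groupG p| = #|'I_n|.
  rewrite card_dep_ffun card_ord foldrE big_map big_enum /=; apply: eq_bigr => i _.
  by rewrite card_ord Zp_cast // prime_gt1.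
have [g gP] : exists g : groupG p, forall i, Tagged (fun i => 'Z_(p i)) (g i) \in s.
  exists [ffun i => xchoose (full i)] => i; rewrite ffunE; exact: (xchooseP (full i)).
(* The injective map [f] goes between sets of the same size n, so it is onto: the surjective half of
   the Chinese remainder theorem. *)
have /codomP [x gx] := inj_card_onto f_inj (eq_leq card_G) g.
exists x => //; apply/esym/eqP; rewrite eqEcard sk card_top_face leqnn andbT.
by apply/subsetP => v /imsetP [i _ ->]; have := gP i; rewrite gx ffunE.
Qed.

Definition coord_sign i : int := (-1) ^+ #|[set j : 'I_k.+1 | (j < i)%N]|.

Lemma incidence_top i m :
  incidence (top_face m) (top_face m :\ vtx i m) = coord_sign i.
Proof.
rewrite incidenceD1 ?vtx_top // /vertex_sign /coord_sign; congr (_ ^+ _).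
rewrite -(card_imset _ (@vtx_inj m)); apply: eq_card => v; rewrite inE mem_top_face.
apply/andP/imsetP => [[/eqP -> lt]|[j]].
  exists (tag v) => //; rewrite inE ltnNge; apply/negP; rewrite leq_eqVlt.
  case/orP=> [/eqP/val_inj e|h]; first by rewrite -e ltnn in lt.
  by have := @enum_rank_tag _ _ (vtx i m) (vtx (tag v) m) h; rewrite ltnNge ltnW.
rewrite inE => ji -> /=; split=> //.
exact: enum_rank_tag.
Qed.

Lemma cobd_top y m :
  cobd y (top_face m) = \sum_i coord_sign i * y (top_face m :\ vtx i m).
Proof.
rewrite cobdE /top_face big_imset /=; last by move=> i j _ _; apply: vtx_inj.
by apply: eq_bigr => i _; rewrite incidence_top.
Qed.

(** Deleting the vertex over [i] forgets the residue modulo [p i]; the other vertices depend only on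
    m modulo n / p_i. *)
Lemma top_face_facet i m : top_face m :\ vtx i m =
  top_face (m %% (\prod_(j | j != i) p j))%N :\ vtx i (m %% (\prod_(j | j != i) p j))%N.
Proof.
set m' := (m %% _)%N.
have e j : j != i -> vtx j m = vtx j m'.
  move=> ji; apply: vtx_eq_mod; rewrite modn_dvdm // (bigD1 j) //=.
  exact: dvdn_mulr.
apply/setP => v; rewrite !inE !mem_top_face.
have [ti|ti] := eqVneq (tag v) i; first by rewrite ti !andNb.
have ne m1 : v != vtx i m1 by apply: contraNneq ti => ->.
by rewrite !ne /= e.
Qed.

(** By [top_face_facet] the i-th summand of the coboundary has period n / p_i in m, hence is a
    multiple of a geometric sum divisible by Phi_n. *)
Lemma cobd_top_dvd y :
  exists g, \poly_(m < n) cobd y (top_face m) = 'Phi_n * g.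
Proof.
have term i : exists g,
   \poly_(m < n) (coord_sign i * y (top_face m :\ vtx i m)) = 'Phi_n * g.
  pose q := (\prod_(j | j != i) p j)%N.
  have nE : n = (p i * q)%N by rewrite /prodp (bigD1 i).
  have q0 : (0 < q)%N by have := prodp_gt0; rewrite nE muln_gt0 => /andP [].
  have [g gE] := Cyclotomic_dvd_geometric (prime_gt1 (p_prime i)) q0.
  pose F r := coord_sign i * y (top_face r :\ vtx i r).
  exists ((\poly_(r < q) F r) * g); rewrite nE mulrCA -gE -poly_periodic.
  by apply: eq_poly => m _; rewrite /F top_face_facet.
have [g gP] := choice term; exists (\sum_i g i); rewrite mulr_sumr.
under [RHS]eq_bigr => i _ do rewrite -gP.
apply/polyP => m; rewrite coef_sum coef_poly.
under [RHS]eq_bigr => i _ do rewrite coef_poly.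
by case: ifP => _; [rewrite cobd_top | rewrite big1].
Qed.

Definition top_cochain (b : nat -> int) (s : {set vertex p}) : int :=
  \sum_(x < n) (s == top_face x)%:R * b x.

Lemma top_cochainE b m : (m < n)%N -> top_cochain b (top_face m) = b m.
Proof.
move=> mn; rewrite /top_cochain (bigD1 (Ordinal mn)) //= eqxx mul1r.
rewrite big1 ?addr0 // => x xm.
case: eqP => [/top_face_inj e|_]; last by rewrite mul0r.
by case/eqP: xm; apply: val_inj; rewrite /= e.
Qed.

Lemma top_cochain_out b (s : {set vertex p}) : #|s| != k.+1 -> top_cochain b s = 0.
Proof.
move=> sk; rewrite /top_cochain big1 // => x _.
case: eqP => [e|_]; last by rewrite mul0r.
by rewrite e card_top_face eqxx in sk.
Qed.

Lemma top_cochain_notin b (s : {set vertex p}) : s \notin Y -> top_cochain b s = 0.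
Proof.
move=> sY; rewrite /top_cochain big1 // => x _.
case: eqP => [e|_]; last by rewrite mul0r.
by rewrite e top_face_Y in sY.
Qed.

Definition base_vtx i : vertex p := Tagged (fun i => 'Z_(p i)) (0 : 'Z_(p i)).

(** [Y] has no faces above dimension k, so a top cochain is a cocycle. If m is not prime to n, some
    [p i] divides it, and its top face has the base vertex over [i], where [cocycle_cobd] is
    exact. *)
Lemma cobd_top_reduce (b : nat -> int) : exists y, forall m, (m < n)%N ->
  ~~ coprime n m -> cobd y (top_face m) = b m.
Proof.
have [s sY|y yP] := @cocycle_cobd _ _ (@tag _ _) base_vtx Y (fun i => erefl) complexYP
    (top_cochain b).
  rewrite cobdE big1 // => v vs; rewrite top_cochain_out ?mulr0 //.
  have := card_face sY; rewrite (cardsD1 v) vs add1n ltnS => /leq_ltn_trans h.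
  by rewrite ltn_eqF ?h.
exists y => m mn; rewrite coprime_sym coprime_prodn => /allPn [i _].
rewrite coprime_sym prime_coprime // negbK => pm.
rewrite (yP i) ?top_face_Y ?top_cochainE //; apply/avoidsP => v.
rewrite mem_top_face => /eqP -> /= ->; rewrite /base_vtx /vtx; congr (Tagged _ _).
apply: val_inj => /=; rewrite Zp_cast ?prime_gt1 //; exact/eqP.
Qed.

Lemma cyclotomic_size_le g N : (size ('Phi_n * g)%R <= phi + N)%N -> (size g <= N)%N.
Proof.
have [->|g0] := eqVneq g 0; first by rewrite size_poly0.
by rewrite (size_monicM (Cyclotomic_monic _) g0) size_Phi addSn leq_add2l.
Qed.

Lemma dvd_cobd_top g : (size ('Phi_n * g)%R <= n)%N ->
  exists y, forall m, (m < n)%N -> cobd y (top_face m) = ('Phi_n * g)`_m.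
Proof.
move=> sg; pose E := [seq m <- iota 0 n | coprime n m].
have size_E : size E = phi.
  rewrite size_filter -totient_prodp totient_count_coprime /index_iota subn0.
  by rewrite -sum1_count big_mkcond.
(* Enumerates the phi exponents below n that are prime to n. *)
pose e (l : 'I_phi) := nth 0%N E l.
have polyE (h : nat -> int) : (forall m, (m < n)%N -> ~~ coprime n m -> h m = 0) ->
    \poly_(m < n) h m = \sum_l (\row_l h (e l)) 0 l *: 'X^(e l).
  move=> h0; under [RHS]eq_bigr => l _ do rewrite mxE.
  rewrite -(big_mkord predT (fun l => h (nth 0%N E l) *: 'X^(nth 0%N E l))).
  rewrite -size_E -(big_nth 0%N predT (fun m => h m *: 'X^m)) /E big_filter.
  rewrite poly_def -(big_mkord predT (fun m => h m *: 'X^m)) [RHS]big_mkcond.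
  rewrite /index_iota subn0; apply: eq_big_seq => m; rewrite mem_iota => /= mn.
  by case: ifP => // /negbT cm; rewrite h0 ?scale0r.
have polyB (b h : nat -> int) :
    \poly_(m < n) b m = \poly_(m < n) (b m - h m) + \poly_(m < n) h m.
  by apply/polyP => m; rewrite coefD !coef_poly; case: ifP; rewrite ?addr0 ?subrK.
have free := @monomials_free phi 'Phi_n (Cyclotomic_monic _) size_Phi e.
have span (m : 'I_phi) : exists x : 'rV[int]_phi,
     exists g, 'X^m = \sum_l x 0 l *: 'X^(e l) + 'Phi_n * g.
  (* Subtracting a coboundary, a multiple of Phi_n, from X^m leaves only exponents prime to n. *)
  have [y yP] := cobd_top_reduce (fun m' => (m' == m)%:R).
  have [g' gE] := cobd_top_dvd y.
  exists (\row_l ((e l == m)%:R - cobd y (top_face (e l)))), g'.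
  rewrite -gE -(polyE (fun m' => (m' == m)%:R - cobd y (top_face m'))).
    rewrite -polyB; apply/polyP => m'; rewrite coefXn coef_poly.
    case: ifP => // /negbT mn; case: eqP => // e1; exfalso.
    by have := ltn_ord m; have := phip_lt_prodp; lia.
  by move=> m' mn' cm; rewrite yP // subrr.
have [y yP] := cobd_top_reduce (fun m => ('Phi_n * g)`_m).
have [g' gE] := cobd_top_dvd y.
(* [h] is supported on exponents prime to n and is a multiple of Phi_n, so freeness forces it to
   vanish. *)
pose h m := ('Phi_n * g)`_m - cobd y (top_face m).
have h0 m : (m < n)%N -> ~~ coprime n m -> h m = 0.
  by move=> mn cm; rewrite /h yP // subrr.
have hE : \poly_(m < n) h m = 'Phi_n * (g - g').
  apply/eqP; rewrite mulrBr eq_sym subr_eq -gE -polyB; apply/eqP/polyP => m.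
  rewrite coef_poly; case: ltnP => // mn; rewrite nth_default //.
  exact: leq_trans sg mn.
have x0 := free span _ _ (etrans (esym (polyE h h0)) hE).
exists y => m mn; apply/eqP; rewrite eq_sym -subr_eq0.
have := congr1 (fun q : {poly int} => q`_m) (polyE h h0).
rewrite coef_poly mn x0 => e1; apply/eqP; rewrite -/(h m) e1.
by rewrite big1 ?coef0 // => l _; rewrite mxE scale0r.
Qed.

Lemma pairing_bd_cobd (c y : {set vertex p} -> int) :
  \sum_t bd c t * y t = \sum_s c s * cobd y s.
Proof.
under eq_bigr => t _ do rewrite /bd mulr_suml.
rewrite exchange_big; apply: eq_bigr => s _; rewrite /cobd mulr_sumr.
by apply: eq_bigr => t _; rewrite -mulrA mulrCA.
Qed.

Lemma pairing_top f y :
  \sum_t bd (top_cochain f) t * y t = \sum_(m < n) f m * cobd y (top_face m).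
Proof.
rewrite pairing_bd_cobd /top_cochain.
under eq_bigr => s _ do rewrite mulr_suml.
rewrite exchange_big; apply: eq_bigr => m _ /=.
rewrite (bigD1 (top_face m)) //= eqxx mul1r big1 ?addr0 // => s sm.
by rewrite (negPf sm) !mul0r.
Qed.

Local Notation shift := (shift_pairing phi 'Phi_n).

(** A top chain is a cycle exactly when it is orthogonal to all top coboundaries, and these have the
    basis X^j Phi_n with j < n - phi. *)
Lemma bd_top_eq0 f : (forall t, bd (top_cochain f) t = 0) <->
  (forall j : nat, (j < n - phi)%N -> shift f j = 0).
Proof.
have nE : (phi + (n - phi) = n)%N by rewrite subnKC // ltnW ?phip_lt_prodp.
have mulE := pairing_mul (Cyclotomic_monic n) size_Phi f.
split=> [f0 j jN|f0 t].
  have sX : (size ('X^j : {poly int}) <= n - phi)%N by rewrite size_polyXn.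
  have [|y yP] := @dvd_cobd_top 'X^j.
    rewrite size_mulXn ?monic_neq0 ?Cyclotomic_monic // size_Phi.
    by have := phip_lt_prodp; lia.
  have := mulE _ _ sX; rewrite nE (bigD1 (Ordinal jN)) //= coefXn eqxx mul1r.
  rewrite [X in _ + X]big1 ?addr0 => [<-|i ij]; last first.
    by rewrite -val_eqE in ij; rewrite coefXn (negPf ij) mul0r.
  under eq_bigr => m _ do rewrite -yP //.
  by rewrite -pairing_top big1 // => t _; rewrite f0 mul0r.
(* Pairing with the indicator of [t] reads off the boundary at [t]. *)
pose y s : int := (s == t)%:R.
have -> : bd (top_cochain f) t = \sum_s bd (top_cochain f) s * y s.
  rewrite (bigD1 t) //= /y eqxx mulr1 big1 ?addr0 // => s st.
  by rewrite (negPf st) mulr0.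
rewrite pairing_top; have [g gE] := cobd_top_dvd y.
have sg : (size g <= n - phi)%N by apply: cyclotomic_size_le; rewrite nE -gE size_poly.
transitivity (\sum_(m < phi + (n - phi)) f m * ('Phi_n * g)`_m).
  by rewrite nE; apply: eq_bigr => m _; rewrite -gE coef_poly ltn_ord.
by rewrite mulE // big1 // => j _; rewrite f0 ?mulr0.
Qed.

Lemma top_cochainB f g s :
  top_cochain (fun m => f m - g m) s = top_cochain f s - top_cochain g s.
Proof. by rewrite /top_cochain -sumrB; apply: eq_bigr => m _; rewrite mulrBr. Qed.

Lemma top_cochainZ a f s : top_cochain (fun m => a * f m) s = a * top_cochain f s.
Proof. by rewrite /top_cochain mulr_sumr; apply: eq_bigr => m _; rewrite mulrCA. Qed.

Lemma small_face_misses (s : {set vertex p}) : (#|s| <= k)%N ->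
  exists i, misses (@tag _ _) i s.
Proof.
move=> sk; have : [set tag v | v in s] != [set: 'I_k.+1].
  apply: contraTneq sk => e; rewrite -ltnNge -[X in (X <= _)%N]card_ord -cardsT -e.
  exact: leq_imset_card.
rewrite -subTset => /subsetPn [i _ iS]; exists i; apply/missesP => v vs e.
by case/negP: iS; rewrite -e imset_f.
Qed.

Lemma misses_avoids i (s : {set vertex p}) :
  misses (@tag _ _) i s -> avoids (@tag _ _) base_vtx i s.
Proof. by move/missesP=> h; apply/avoidsP => v /h. Qed.

Lemma cycle_bd_small c : (forall s, s \notin Y -> c s = 0) ->
  (forall t, bd c t = 0) ->
  exists2 b, forall s, s \notin Y -> b s = 0 &
    forall t : {set vertex p}, (#|t| <= k)%N -> bd b t = c t.
Proof.
move=> cY c0.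
have [b bY bP] := cycle_bd (w := base_vtx) (fun i => erefl) complexYP cY c0.
by exists b => // t /small_face_misses [i ti]; apply: (bP i).
Qed.

Lemma cocycle_cobd_small c : (forall s, s \in Y -> cobd c s = 0) ->
  exists b, forall s : {set vertex p}, s \in Y -> (#|s| <= k)%N -> cobd b s = c s.
Proof.
move=> c0; have [b bP] := cocycle_cobd (w := base_vtx) (fun i => erefl) complexYP c0.
exists b => s sY /small_face_misses [i si]; apply: (bP i) => //.
exact: misses_avoids.
Qed.

End TopFaces.

(** * The complexes K_A *)

Section CyclotomicComplex.
Variables (k : nat) (p : 'I_k.+1 -> nat).
Hypotheses (p_prime : forall i, prime (p i)) (p_inj : injective p).
Variable A : {set 'I_(phip p).+1}.
Hypothesis A_neq0 : A != set0.
Local Notation n := (prodp p).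
Local Notation phi := (phip p).
Local Notation Y := (complexY p).
Local Notation K := (complexK A).
Local Notation d := (gcd_coefs A).
Local Notation r := #|A|.-1.
Local Notation shift := (shift_pairing phi 'Phi_n).
Implicit Types (m : nat) (i j : int).

Let Phi_monic := Cyclotomic_monic n.
Let sPhi := size_Phi p_prime p_inj.
Let phi_lt_n := phip_lt_prodp p_prime p_inj.

Definition inA m := [exists x in A, val x == m].
Definition inD m := (phi < m)%N || inA m.

Lemma inA_leq m : inA m -> (m <= phi)%N.
Proof. by case/exists_inP=> x _ /eqP <-; rewrite -ltnS ltn_ord. Qed.

Lemma top_face_K m : (m < n)%N -> (top_face p m \in K) = inD m.
Proof.
move=> mn; have n2 : (Zp_trunc n).+2 = n by rewrite Zp_cast ?prodp_gt1.
rewrite in_setU mem_skeleton_k card_top_face ltnn andbF /=.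
apply/imsetP/idP => [[_ /imsetP [x xS ->]]|mD].
  rewrite simplex_of_theta => /(top_face_inj p_prime p_inj mn).
  have xn : (x < n)%N by rewrite -[X in (_ < X)%N]n2.
  move=> /(_ xn) e; move: xS; rewrite in_setU => /orP [/imsetP [a aA xa]|].
    apply/orP; right; apply/exists_inP; exists a => //.
    rewrite e xa /= n2 modn_small //; exact: leq_ltn_trans (leq_ord a) phi_lt_n.
  by rewrite inE -e /inD => ->.
have mE : val (inZp m : 'Z_n) = m by rewrite /= n2 modn_small.
exists (theta (inZp m : 'Z_n)); last by rewrite simplex_of_theta mE.
apply: imset_f; rewrite in_setU; case/orP: mD => [mphi|/exists_inP [x xA /eqP xm]].
  by rewrite [_ \in setA0 p]inE mE mphi orbT.
by apply/orP; left; apply/imsetP; exists x => //; rewrite xm.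
Qed.

Lemma small_K (s : {set vertex p}) : (#|s| <= k)%N -> (s \in K) = (s \in Y).
Proof.
move=> sk; rewrite in_setU mem_skeleton_k sk andbT.
have [//|sY /=] := boolP (s \in Y); apply/negP => /imsetP [g _ sg].
by rewrite sg simplex_of_face in sY.
Qed.

Lemma K_sub_Y (s : {set vertex p}) : s \in K -> s \in Y.
Proof.
rewrite in_setU mem_skeleton_k => /orP [/andP [] //|/imsetP [g _ ->]].
exact: simplex_of_face.
Qed.

Lemma dim_card (s : {set vertex p}) i : dim s = i -> #|s|%:Z = i + 1.
Proof. by rewrite /dim => <-; rewrite subrK. Qed.

Lemma card_simplex i (s : simplex K i) : #|val s|%:Z = i + 1.
Proof. by have /andP [_ /eqP/dim_card] := valP s. Qed.

Lemma dim_simplex i (s : simplex K i) : dim (val s) = i.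
Proof. by have /andP [_ /eqP] := valP s. Qed.

Lemma simplex_small i (s : simplex K i) : i < k -> (#|val s| <= k)%N.
Proof. by have := card_simplex s; lia. Qed.

Lemma simplex_K i (s : simplex K i) : val s \in K.
Proof. by have /andP [] := valP s. Qed.

Lemma simplex_K_dim i (s : simplex K i) : i <= k.
Proof.
have /andP [/K_sub_Y/card_face sk /eqP/dim_card] := valP s; lia.
Qed.

Lemma chain_high i (c : chain K i) : (k%:Z < i)%R -> c = 0.
Proof. by move=> ki; apply/ffunP => s; have := simplex_K_dim s; lia. Qed.

Lemma top_simplexP i (s : simplex K i) : i = k ->
  exists2 m, (m < n)%N && inD m & val s = top_face p m.
Proof.
move=> ik; have /andP [sK /eqP/dim_card ds] := valP s.
have [|m mn e] := face_is_top p_prime p_inj (K_sub_Y sK); first by lia.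
by exists m => //; rewrite mn -top_face_K // -e.
Qed.

Lemma ext_top i (c : chain K i) m : i = k -> (m < n)%N -> ~~ inD m ->
  ext c (top_face p m) = 0.
Proof. by move=> ik mn mD; rewrite ext_out // top_face_K // (negPf mD). Qed.

Lemma ext_top_cochain i (c : chain K i) s : i = k ->
  ext c s = top_cochain (fun m => ext c (top_face p m)) s.
Proof.
move=> ik; have [sk|sk] := eqVneq #|s| k.+1; last first.
  rewrite top_cochain_out // ext_out //.
  by apply: contra sk => /andP [_ /eqP/dim_card]; lia.
have [sY|sY] := boolP (s \in Y).
  have [m mn ->] := face_is_top p_prime p_inj sY sk.
  by rewrite (top_cochainE p_prime p_inj).
rewrite top_cochain_notin // ext_out //; apply: contra sY => /andP [/K_sub_Y //].
Qed.

Lemma ext_res_top i f s : i = k -> (forall m, (m < n)%N -> ~~ inD m -> f m = 0) ->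
  ext (res K i (top_cochain f)) s = top_cochain f s.
Proof.
move=> ik fD; rewrite (ext_top_cochain _ _ ik) /top_cochain; apply: eq_bigr => m _.
congr (_ * _); have [mD|mD] := boolP (inD m); last by rewrite ext_top // fD.
rewrite ext_res; first exact: (top_cochainE p_prime p_inj).
by rewrite top_face_K // mD dim_top_face ik eqxx.
Qed.

Lemma boundary_top i j (f : nat -> int) (t : simplex K j) : i = k -> j = k%:Z - 1 ->
  (forall m, (m < n)%N -> ~~ inD m -> f m = 0) ->
  boundary j (res K i (top_cochain f)) t = bd (top_cochain f) (val t).
Proof.
move=> ik jk fD; rewrite boundaryE; apply: eq_bigr => s _.
by rewrite ext_res_top.
Qed.

(** * Degrees below k - 1 and above k *)

Lemma homology_low i : i < k%:Z - 1 -> reduced_homology K i ≅ free_zmod 0.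
Proof.
move=> ik; apply: ker_mod_im_eq0 => v /boundary_eq0 v0.
have [|b bY bP] := cycle_bd_small _ v0.
  move=> s sY; rewrite ext_out //; apply: contra sY => /andP [/K_sub_Y //].
(* As i + 1 is at most k - 1, the bounding chain found in [Y] only uses faces of the (k-1)-skeleton,
   which [K] contains. *)
exists (res K (i + 1) b); apply/ffunP => t.
have dt := card_simplex t.
rewrite boundary_res //; first by rewrite bP ?ext_val //; lia.
move=> s /dim_card ds sK; apply: bY; apply: contra sK => sY.
by rewrite small_K //; lia.
Qed.

Lemma homology_high i : k%:Z < i -> reduced_homology K i ≅ free_zmod 0.
Proof.
by move=> ki; apply: ker_mod_im_eq0 => v _; exists 0; rewrite raddf0 (chain_high v ki).
Qed.

Lemma cohomology_high i : k%:Z < i -> reduced_cohomology K i ≅ free_zmod 0.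
Proof.
by move=> ki; apply: ker_mod_im_eq0 => v _; exists 0; rewrite raddf0 (chain_high v ki).
Qed.

Lemma cocycle_lift i (v : chain K i) : i < k ->
  (forall s, s \in Y -> cobd (ext v) s = 0) ->
  exists u : chain K (i - 1), coboundary i u = v.
Proof.
move=> ik v0; have [b bP] := cocycle_cobd_small v0.
exists (res K (i - 1) b); apply/ffunP => s; rewrite coboundary_res //.
have ds := card_simplex s; have sK := simplex_K s.
by rewrite bP ?ext_val ?K_sub_Y //; lia.
Qed.

Lemma cohomology_low i : i < k%:Z - 1 -> reduced_cohomology K i ≅ free_zmod 0.
Proof.
move=> ik; apply: ker_mod_im_eq0 => v /coboundary_eq0 v0.
apply: cocycle_lift => [|s sY]; first by lia.
(* Faces of [Y] of dimension i + 1 < k all belong to [K], so a cocycle of [K] is already one of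
   [Y]. *)
have [/dim_card ds|] := eqVneq (dim s) (i + 1); last exact: cobd_ext_dim.
by apply: v0; rewrite small_K //; lia.
Qed.

(** * Cohomology in degree k - 1 *)

Lemma cocycle_multiple i (v : chain K i) :
  (forall m, (m < n)%N -> (phi < m)%N -> cobd (ext v) (top_face p m) = 0) ->
  exists t : int, forall m, (m < n)%N -> cobd (ext v) (top_face p m) = t * ('Phi_n)`_m.
Proof.
move=> v0; have [g gE] := cobd_top_dvd p_prime (ext v).
(* The multiple of Phi_n has no exponent above phi, so its cofactor is constant. *)
have sg : (size g <= 1)%N.
  apply: (cyclotomic_size_le p_prime p_inj); rewrite -gE addn1.
  apply/leq_sizeP => m pm; rewrite coef_poly; case: ifP => // mn; exact: v0.
exists g`_0 => m mn; have := congr1 (fun q : {poly int} => q`_m) gE.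
by rewrite coef_poly mn (size1_polyC sg) mulrC mul_polyC coefZ coefC.
Qed.

Lemma Phi_out m : (phi < m)%N -> ('Phi_n)`_m = 0.
Proof. by move=> pm; rewrite nth_default // sPhi. Qed.

Lemma Phi_phi : ('Phi_n)`_phi = 1.
Proof. exact: monic_coef_phi Phi_monic sPhi. Qed.

Lemma top_cochain_lift (t : int) : exists y, forall m, (m < n)%N ->
  cobd y (top_face p m) = t * ('Phi_n)`_m.
Proof.
have [|y yP] := @dvd_cobd_top _ _ p_prime p_inj t%:P.
  by rewrite mulrC mul_polyC (leq_trans (size_scale_leq _ _)) // sPhi.
by exists y => m mn; rewrite yP // mulrC mul_polyC coefZ.
Qed.

(** Stated for every [z], 0 included: z = 0 gives the criterion for d = 0, and general [z] is what
    [row_unimodular] requires. *)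
Lemma gcd_coefsP (z : int) :
  (forall m, inA m -> (z %| ('Phi_n)`_m)%Z) <-> (z %| d%:Z)%Z.
Proof.
split=> [h|].
  rewrite dvdzE; apply/dvdn_biggcdP => x xA; rewrite -dvdzE.
  by apply: h; apply/exists_inP; exists x.
rewrite dvdzE => /dvdn_biggcdP h m /exists_inP [x xA /eqP <-]; rewrite dvdzE.
exact: h.
Qed.

Lemma gcd_coefs_eq0 : d = 0%N <-> forall m, inA m -> ('Phi_n)`_m = 0.
Proof.
split=> [d0 m mA|h].
  by apply/eqP; rewrite -dvd0z; move: m mA; apply/gcd_coefsP; rewrite d0.
have /gcd_coefsP : forall m, inA m -> (0 %| ('Phi_n)`_m)%Z.
  by move=> m /h ->; rewrite dvd0z.
by rewrite dvd0z => /eqP [].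
Qed.

Lemma cocycle_zero_lift i (v : chain K i) : i = k%:Z - 1 ->
  (forall m, (m < n)%N -> cobd (ext v) (top_face p m) = 0) ->
  exists u : chain K (i - 1), coboundary i u = v.
Proof.
move=> ik v0; apply: cocycle_lift => [|s sY]; first by lia.
have [/dim_card ds|] := eqVneq (dim s) (i + 1); last exact: cobd_ext_dim.
have [|m mn ->] := face_is_top p_prime p_inj sY; first by lia.
exact: v0.
Qed.

(** Vanishing on A_0 makes the coboundary taken in [Y] a constant multiple [t] of Phi_n; vanishing
    on A then says that t c_A = 0. *)
Lemma cocycle_K i (v : chain K i) : coboundary (i + 1) v = 0 ->
  exists2 t : int, forall m, (m < n)%N -> cobd (ext v) (top_face p m) = t * ('Phi_n)`_m
    & forall m, inA m -> t * ('Phi_n)`_m = 0.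
Proof.
move=> /coboundary_eq0 v0; have [|t tP] := @cocycle_multiple i v.
  by move=> m mn pm; apply: v0; rewrite top_face_K // /inD pm.
exists t => // m mA; have mn := leq_ltn_trans (inA_leq mA) phi_lt_n.
by rewrite -tP // v0 // top_face_K // /inD mA orbT.
Qed.

Lemma cohomology_pred_neq0 i : i = k%:Z - 1 -> d != 0%N ->
  reduced_cohomology K i ≅ free_zmod 0.
Proof.
move=> ik d0; apply: ker_mod_im_eq0 => v /cocycle_K [t tP tA].
apply: cocycle_zero_lift => // m mn; rewrite tP //.
have [->|t0] := eqVneq t 0; first by rewrite mul0r.
case/eqP: d0; apply/gcd_coefs_eq0 => x /tA/eqP; rewrite mulf_eq0 (negPf t0).
by move/eqP.
Qed.

Lemma cohomology_pred_eq0 i : i = k%:Z - 1 -> d = 0%N -> reduced_cohomology K i ≅ int.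
Proof.
(* The coboundary of [y] in [Y] is Phi_n itself, which vanishes on A and A_0 since c_A = 0; so [y]
   restricts to a cocycle of [K], the generator. *)
move=> ik /gcd_coefs_eq0 d0; have [y yP] := top_cochain_lift 1.
have resE j s t : j = i -> t = j + 1 -> dim s = t -> s \in Y ->
  forall z, cobd (ext (res K j z)) s = cobd z s.
  move=> ji tj /dim_card ds sY z; rewrite !cobdE; apply: eq_bigr => v vs.
  have c := cardsD1 v s; rewrite vs in c.
  rewrite ext_res // small_K ?(sub_face (subD1set _ _) sY) /dim; lia.
pose psi (a : int) : chain K i := res K i (fun s => a * y s).
have psi_top a m : (m < n)%N -> cobd (ext (psi a)) (top_face p m) = a * ('Phi_n)`_m.
  move=> mn; rewrite (resE _ _ k) ?dim_top_face ?top_face_Y //; last by lia.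
  rewrite -[('Phi_n)`_m]mul1r -yP // /cobd mulr_sumr.
  by apply: eq_bigr => t _; rewrite mulrCA.
have psiB : zmod_morphism psi.
  by move=> a b; apply/ffunP => s; rewrite !ffunE mulrBl.
apply: (@ker_mod_im_iso _ _ _ int int _ _ psi id psiB) => //.
- move=> a; apply/coboundary_eq0 => s sK.
  have [ds|] := eqVneq (dim s) (i + 1); last exact: cobd_ext_dim.
  have [|m mn e] := face_is_top p_prime p_inj (K_sub_Y sK).
    by have := dim_card ds; lia.
  rewrite e psi_top //; move: sK; rewrite e top_face_K //.
  by case/orP => [/Phi_out|/d0] ->; rewrite mulr0.
- by move=> t; exists t.
- move=> v /cocycle_K [t tP _]; exists t.
  have [|u uE] := @cocycle_zero_lift i (v - psi t) ik.
    move=> m mn; have -> : cobd (ext (v - psi t)) (top_face p m) =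
      cobd (ext v) (top_face p m) - cobd (ext (psi t)) (top_face p m).
      rewrite -cobdB; apply: eq_bigr => s _; congr (_ * _); rewrite /ext.
      by case: insubP => /= [x _ _|_]; rewrite ?ffunE ?subrr //; rewrite !ffunE.
    by rewrite psi_top // tP // subrr.
  by exists u; rewrite /= uE addrC subrK.
- move=> a; split=> [->|[u /= uE]].
    by exists 0; rewrite raddf0; apply/esym; rewrite -(subrr 0) psiB subrr.
  (* Phi_n has coefficient 1 at phi, so [a] is the value there of the coboundary of a coboundary,
     which is 0. *)
  have := psi_top a phi phi_lt_n; rewrite -uE Phi_phi mulr1 => <-.
  have -> : coboundary i u = res K i (cobd (ext u)).
    by apply/ffunP => s; rewrite coboundaryE ffunE.
  rewrite (resE _ _ k) ?dim_top_face ?top_face_Y ?cobd_cobd //; lia.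
Qed.

(** * Vectors indexed by A, and cohomology in degree k *)

Lemma card_A : r.+1 = #|A|.
Proof. by rewrite prednK // card_gt0. Qed.

Definition elt_A (l : 'I_r.+1) : nat := val (enum_val (cast_ord card_A l)).

Lemma elt_A_inj : injective elt_A.
Proof. by move=> l l' /val_inj/enum_val_inj/cast_ord_inj. Qed.

Lemma inA_elt l : inA (elt_A l).
Proof.
apply/exists_inP; exists (enum_val (cast_ord card_A l)) => //; exact: enum_valP.
Qed.

Lemma inAP m : inA m -> exists l, m = elt_A l.
Proof.
case/exists_inP=> x xA /eqP <-; exists (cast_ord (esym card_A) (enum_rank_in xA x)).
by rewrite /elt_A cast_ordKV enum_rankK_in.
Qed.

Definition zero_ext (x : 'rV[int]_r.+1) m : int := \sum_l x 0 l * (m == elt_A l)%:R.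

Lemma zero_ext_elt x l : zero_ext x (elt_A l) = x 0 l.
Proof.
rewrite /zero_ext (bigD1 l) //= eqxx mulr1 big1 ?addr0 // => l' l'l.
by rewrite (inj_eq elt_A_inj) eq_sym (negPf l'l) mulr0.
Qed.

Lemma zero_ext_out x m : ~~ inA m -> zero_ext x m = 0.
Proof.
move=> mA; rewrite /zero_ext big1 // => l _; case: eqP => [e|_]; last by rewrite mulr0.
by rewrite e inA_elt in mA.
Qed.

Lemma zero_extB x y m : zero_ext (x - y) m = zero_ext x m - zero_ext y m.
Proof. by rewrite /zero_ext -sumrB; apply: eq_bigr => l _; rewrite !mxE mulrBl. Qed.

Lemma zero_ext_D x m : ~~ inD m -> zero_ext x m = 0.
Proof. by rewrite negb_or => /andP [_ /zero_ext_out]. Qed.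

Lemma zero_ext_high x m : (phi < m)%N -> zero_ext x m = 0.
Proof.
by move=> pm; apply: zero_ext_out; apply/negP => /inA_leq; rewrite leqNgt pm.
Qed.

Lemma zero_ext_restrict (f : nat -> int) m : (m <= phi)%N ->
  (~~ inA m -> f m = 0) -> zero_ext (\row_l f (elt_A l)) m = f m.
Proof.
move=> mp f0; have [/inAP [l ->]|mA] := boolP (inA m); last by rewrite zero_ext_out ?f0.
by rewrite zero_ext_elt mxE.
Qed.

Definition coef_row : 'rV[int]_r.+1 := \row_l ('Phi_n)`_(elt_A l).

(** The equation at shift 0, the one left over by [recurrence_extend], is the pairing with c_A. *)
Lemma shift_zero_ext x : shift (zero_ext x) 0 = \sum_l x 0 l * coef_row 0 l.
Proof.
rewrite /shift_pairing /zero_ext.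
under eq_bigr => m _ do rewrite addn0 mulr_sumr.
rewrite exchange_big; apply: eq_bigr => l _; rewrite mxE.
have lp : (elt_A l < phi.+1)%N by rewrite ltnS inA_leq ?inA_elt.
rewrite (bigD1 (Ordinal lp)) //= eqxx mulr1 mulrC big1 ?addr0 // => m ml.
by rewrite -val_eqE /= in ml; rewrite (negPf ml) !mulr0.
Qed.

Lemma coef_row_unimodular :
  exists2 U : 'M[int]_r.+1, U \in unitmx & coef_row = d%:Z *: row 0 U.
Proof.
apply: row_unimodular => z; rewrite -gcd_coefsP; split=> [h m /inAP [l ->]|h l].
  by have := h l; rewrite mxE.
by rewrite mxE; apply: h; apply: inA_elt.
Qed.

Lemma int_mod_pi_eq0 (e : nat) (a : int) :
  (\pi_(int_mod e)%qT a == 0) = (e%:Z %| a)%Z.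
Proof.
have -> : (0 : int_mod e) = \pi_(int_mod e)%qT 0 by rewrite raddf0.
by rewrite -Quotient.idealrBE subr0.
Qed.

Lemma cohomology_top i : i = k ->
  reduced_cohomology K i ≅ dsum (free_zmod r) (int_mod d).
Proof.
move=> ik; have [U Uu cU] := coef_row_unimodular.
pose psi x : chain K i := res K i (top_cochain (zero_ext x)).
have psiB : zmod_morphism psi.
  move=> x y; apply/ffunP => s; rewrite !ffunE -top_cochainB.
  by apply: eq_bigr => m _; rewrite zero_extB.
have psiE x (s : simplex K i) m : (m < n)%N -> val s = top_face p m ->
    psi x s = zero_ext x m.
  by move=> mn e; rewrite ffunE e (top_cochainE p_prime p_inj).
(* In the basis formed by the rows of [U], c_A is [d] times the first basis vector; so the first
   coordinate is read modulo [d] and the others are kept. *)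
pose rho (x : 'rV[int]_r.+1) : dsum (free_zmod r) (int_mod d) :=
  (\row_l (x *m invmx U) 0 (lift ord0 l), \pi_(int_mod d)%qT ((x *m invmx U) 0 0)).
have rhoB : zmod_morphism rho.
  move=> x y; rewrite /rho mulmxBl; move: (x *m _) (y *m _) => a b.
  congr pair; first by apply/rowP => l; rewrite !mxE.
  by rewrite mxE [in LHS]mxE; exact: raddfB.
have rho0 x : rho x = 0 <-> exists t, x = t *: coef_row.
  split=> [[/rowP r0 /eqP]|[t ->]].
    rewrite int_mod_pi_eq0 => /dvdzP [t tE]; exists t.
    rewrite -[x](mulmxKV Uu) cU scalerA.
    have -> : x *m invmx U = (t * d%:Z) *: delta_mx 0 0.
      apply/rowP => l; rewrite !mxE /=; have [->|] := eqVneq l 0.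
        by rewrite mulr1 -tE mxE.
      rewrite mulr0; case: (unliftP 0 l) => [l' ->|->] // _.
      by have := r0 l'; rewrite !mxE.
    by rewrite -scalemxAl -rowE.
  rewrite /rho cU scalerA -scalemxAl -row_mul mulmxV // row1.
  congr pair; first by apply/rowP => l; rewrite !mxE mulr0.
  by apply/eqP; rewrite !mxE eqxx mulr1 int_mod_pi_eq0 dvdz_mull.
apply: (@ker_mod_im_iso _ _ _ _ _ _ _ psi rho psiB rhoB).
- by move=> x; apply: chain_high; lia.
- move=> [a b]; pose z : 'rV[int]_r.+1 := \row_l oapp (a 0) (repr b) (unlift ord0 l).
  exists (z *m U); rewrite /rho mulmxK // !mxE unlift_none /= reprK.
  by congr pair; apply/rowP => l; rewrite !mxE liftK.
- move=> v _; pose b m := ext v (top_face p m).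
  (* Multiples of X Phi_n of degree below n are coboundaries, and the remainder modulo this monic
     polynomial has degree at most phi: the exponents in A_0 are eliminated. *)
  pose B := \poly_(m < n) b m; pose Q := 'Phi_n * 'X.
  have Qm : Q \is monic by rewrite monicMl ?monicX.
  have sQ : size Q = phi.+2 by rewrite size_mulX ?monic_neq0 // sPhi.
  have BE := Pdiv.IdomainMonic.divp_eq Qm B.
  set q := B %/ Q in BE; set r' := B %% Q in BE.
  have sr : (size r' <= phi.+1)%N by rewrite -ltnS -sQ ltn_modp monic_neq0.
  have QE : q * Q = 'Phi_n * ('X * q) by rewrite /Q mulrC mulrA.
  have [|y yP] := @dvd_cobd_top _ _ p_prime p_inj ('X * q).
    rewrite -QE (_ : q * Q = B - r'); last by rewrite BE addrK.
    apply: leq_trans (size_polyD _ _) _; rewrite size_polyN geq_max size_poly.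
    exact: leq_trans sr phi_lt_n.
  exists (\row_l r'`_(elt_A l)), (res K (i - 1) y); apply/ffunP => s.
  have [m /andP [mn mD] e] := top_simplexP s ik.
  rewrite [RHS]ffunE (psiE _ _ m) //= coboundary_res // e yP // -QE.
  rewrite -ext_val e -/(b m) (_ : b m = B`_m); last by rewrite coef_poly mn.
  rewrite [in LHS]BE coefD addrC; congr (_ + _).
  case/orP: mD => [pm|mA]; last by rewrite zero_ext_restrict ?mA ?inA_leq.
  by rewrite zero_ext_high // nth_default // (leq_trans sr).
- move=> x; rewrite rho0; split=> [[t xE]|[u /= uE]].
    have [y yP] := top_cochain_lift t.
    exists (res K (i - 1) y); apply/ffunP => s.
    have [m /andP [mn mD] e] := top_simplexP s ik.
    rewrite (psiE _ _ m) //= coboundary_res // e yP //.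
    case/orP: mD => [pm|/inAP [l ->]]; last by rewrite zero_ext_elt xE !mxE.
    by rewrite zero_ext_high // Phi_out // mulr0.
  have uD m : (m < n)%N -> inD m -> cobd (ext u) (top_face p m) = zero_ext x m.
    move=> mn mD; have mK : (top_face p m \in K) && (dim (top_face p m) == i).
      by rewrite top_face_K // mD dim_top_face ik eqxx.
    have := congr1 (fun c : chain K i => c (Sub (top_face p m) mK)) uE.
    by rewrite (psiE _ _ m) // coboundaryE.
  (* The coboundary of [u] vanishes on A_0, so it is a constant multiple of Phi_n, whose
     coefficients on A form c_A. *)
  have [m mn pm|t tP] := @cocycle_multiple _ u.
    by rewrite uD ?/inD ?pm // zero_ext_high.
  exists t; apply/rowP => l; rewrite !mxE -zero_ext_elt.
  have mn := leq_ltn_trans (inA_leq (inA_elt l)) phi_lt_n.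
  by rewrite -uD ?tP // /inD inA_elt orbT.
Qed.

(** * Homology in degree k *)

Lemma cycle_top i (v : chain K i) : i = k -> boundary (i - 1) v = 0 <->
  forall j : nat, (j < n - phi)%N -> shift (fun m => ext v (top_face p m)) j = 0.
Proof.
move=> ik; rewrite boundary_eq0 -(bd_top_eq0 p_prime p_inj).
by split=> h t; rewrite -(h t); apply: eq_bigr => s _; rewrite (ext_top_cochain v s ik).
Qed.

(** A cycle is determined by its values on A, the recurrence yielding those on A_0, and the only
    condition on them is orthogonality to c_A. [L] is any coordinate system on this orthogonal
    lattice, so the cases c_A = 0 and c_A nonzero share the argument. *)
Lemma homology_top i q (L : 'rV[int]_r.+1 -> 'rV[int]_q) : i = k ->
  zmod_morphism L ->
  (forall b, exists2 a : 'rV[int]_r.+1, \sum_l a 0 l * coef_row 0 l = 0 & L a = b) ->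
  (forall a : 'rV[int]_r.+1, \sum_l a 0 l * coef_row 0 l = 0 -> L a = 0 -> a = 0) ->
  reduced_homology K i ≅ free_zmod q.
Proof.
move=> ik LB Lsurj Linj.
have nE : (phi + (n - phi) = n)%N by rewrite subnKC // ltnW.
pose row_of (v : chain K i) : 'rV[int]_r.+1 := \row_l ext v (top_face p (elt_A l)).
have rowB : zmod_morphism row_of.
  move=> v w; apply/rowP => l; rewrite !mxE /ext.
  by case: insubP => /= [s _ _|_]; rewrite ?subrr // !ffunE.
have shift0 (f : nat -> int) : (forall m, (m <= phi)%N -> ~~ inA m -> f m = 0) ->
    shift f 0 = \sum_l (\row_l f (elt_A l)) 0 l * coef_row 0 l.
  move=> f0; rewrite -shift_zero_ext; apply: eq_bigr => l _; rewrite addn0.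
  have lp : (l <= phi)%N by rewrite -ltnS.
  by rewrite zero_ext_restrict // => /f0 ->.
(* There are no (k+1)-chains to divide by, so the correspondence starts from the cycles
   themselves. *)
apply: (@ker_mod_im_iso _ _ _ (kernel (@boundary _ K i (i - 1))) (free_zmod q) _ _
  val (fun x => L (row_of (val x)))).
- by move=> x y; rewrite raddfB.
- by move=> x y; rewrite raddfB rowB LB.
- by move=> x; apply/eqP; exact: (valP x).
- move=> b; have [a a0 <-] := Lsurj b.
  have [f [fa f0]] := recurrence_extend Phi_monic sPhi (zero_ext a).
  have fD m : (m < n)%N -> ~~ inD m -> f m = 0.
    move=> mn mD; rewrite fa ?zero_ext_D //; move: mD; rewrite negb_or -leqNgt.
    by case/andP.
  pose v := res K i (top_cochain f).
  have vE m : (m < n)%N -> ext v (top_face p m) = f m.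
    by move=> mn; rewrite ext_res_top // (top_cochainE p_prime p_inj).
  have vk : boundary (i - 1) v = 0.
    apply/(cycle_top _ ik) => j jN.
    transitivity (shift f j).
      by apply: eq_bigr => l _; rewrite vE //; have := ltn_ord l; lia.
    case: j jN => [_|j jN]; last exact: f0.
    rewrite shift0 => [|m mp mA]; last by rewrite fa // zero_ext_out.
    rewrite -[RHS]a0; apply: eq_bigr => l _; congr (_ * _).
    by rewrite mxE fa ?inA_leq ?inA_elt // zero_ext_elt.
  have kv : v \in in_kernel (@boundary _ K i (i - 1)) by apply/eqP.
  exists (Sub v kv); rewrite /=; congr L; apply/rowP => l; rewrite mxE.
  have ln : (elt_A l < n)%N := leq_ltn_trans (inA_leq (inA_elt l)) phi_lt_n.
  by rewrite vE // fa ?inA_leq ?inA_elt // zero_ext_elt.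
- move=> v v0; have kv : v \in in_kernel (@boundary _ K i (i - 1)) by apply/eqP.
  by exists (Sub v kv), 0; rewrite raddf0 addr0.
- move=> x; have /eqP/(cycle_top _ ik) x0 : boundary (i - 1) (val x) == 0 := valP x.
  split=> [Lx|[u uE]]; last first.
    have u0 : u = 0 by apply: chain_high; lia.
    rewrite -uE u0 raddf0 -(subrr 0) rowB LB subrr //.
  exists 0; rewrite raddf0; apply/esym.
  have out m : (m <= phi)%N -> ~~ inA m -> ext (val x) (top_face p m) = 0.
    move=> mp mA; apply: ext_top => //; first exact: leq_ltn_trans mp phi_lt_n.
    by rewrite negb_or -leqNgt mp.
  have a0 := Linj (row_of (val x)) _ Lx.
  have {}a0 : row_of (val x) = 0.
    by apply: a0; apply: etrans (esym (shift0 _ out)) _; apply: x0; rewrite subn_gt0.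
  have low m : (m <= phi)%N -> ext (val x) (top_face p m) = 0.
    move=> mp; have [/inAP [l ->]|] := boolP (inA m); last exact: out.
    by have := congr1 (fun a : 'rV[int]_r.+1 => a 0 l) a0; rewrite !mxE.
  (* Zero values at 0, ..., phi propagate to A_0 through the recurrence. *)
  have all0 := recurrence_unique Phi_monic sPhi low (N := (n - phi)%N).
  apply/ffunP => s; have [m /andP [mn mD] e] := top_simplexP s ik.
  rewrite ffunE -[LHS]ext_val e; apply: all0; last by rewrite nE.
  by move=> j /andP [_ jN]; apply: x0.
Qed.

Lemma homology_top_eq0 i : i = k -> d = 0%N -> reduced_homology K i ≅ free_zmod #|A|.
Proof.
move=> ik /gcd_coefs_eq0 d0.
have -> : free_zmod #|A| = free_zmod r.+1 := congr1 free_zmod (esym card_A).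
apply: (homology_top (L := id)) => // b; exists b => //.
by rewrite big1 // => l _; rewrite !mxE d0 ?mulr0 ?inA_elt.
Qed.

Lemma homology_top_neq0 i : i = k -> d != 0%N -> reduced_homology K i ≅ free_zmod r.
Proof.
move=> ik d0; have [U Uu cU] := coef_row_unimodular.
(* In the coordinates [a *m U^T], pairing with c_A is [d] times the first one; as [d] is nonzero,
   orthogonality kills exactly this coordinate. *)
have pairE (a : 'rV[int]_r.+1) :
    \sum_l a 0 l * coef_row 0 l = d%:Z * (a *m U^T) 0 0.
  rewrite cU [in RHS]mxE mulr_sumr; apply: eq_bigr => l _; rewrite !mxE; ring.
have UTu : U^T \in unitmx by rewrite unitmx_tr.
apply: (homology_top (L := fun a => \row_l (a *m U^T) 0 (lift ord0 l))) => //.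
- move=> a b; rewrite mulmxBl; apply/rowP => l.
  by move: (a *m _) (b *m _) => a' b'; rewrite !mxE.
- move=> b; pose z : 'rV[int]_r.+1 := \row_l oapp (b 0) 0 (unlift ord0 l).
  exists (z *m invmx U^T).
    by rewrite pairE mulmxKV // mxE unlift_none mulr0.
  by rewrite mulmxKV //; apply/rowP => l; rewrite !mxE liftK.
- move=> a; rewrite pairE => /eqP; rewrite mulf_eq0 eqz_nat (negPf d0) /= => /eqP a0.
  move=> /rowP Lx; rewrite -[a](mulmxK UTu).
  suff -> : a *m U^T = 0 by rewrite mul0mx.
  apply/rowP => l; rewrite [RHS]mxE; case: (unliftP 0 l) => [l' ->|-> //].
  by have := Lx l'; rewrite mxE => ->; rewrite mxE.
Qed.

(** A cycle bounds a top chain of [Y], unique up to cycles of [Y]. Once chains on A_0 are used to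
    make its pairings with X^j Phi_n, j > 0, vanish, its pairing with Phi_n remains, and chains on A
    change this integer by multiples of [d]. *)
Lemma homology_pred i : i = k%:Z - 1 -> reduced_homology K i ≅ int_mod d.
Proof.
move=> ik; have ik1 : i + 1 = k by lia.
(* Since Phi_n has coefficient 1 at phi, [f0] pairs to 1 with Phi_n, and to 0 with its shifts; the
   boundary of [f0] will generate. *)
have [f0 [f0phi f0j]] := recurrence_extend Phi_monic sPhi (fun m => (m == phi)%:R).
have nE : (phi + (n - phi) = n)%N by rewrite subnKC // ltnW.
have shift_f0 : shift f0 0 = 1.
  rewrite /shift_pairing big_ord_recr /= addn0 f0phi // eqxx mulr1 Phi_phi.
  rewrite big1 ?add0r // => l _; rewrite addn0 f0phi 1?ltnW //.
  by rewrite ltn_eqF ?mulr0.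
pose psi (a : int) : chain K i := res K i (fun s => a * bd (top_cochain f0) s).
have psiB : zmod_morphism psi.
  by move=> a b; apply/ffunP => s; rewrite !ffunE mulrBl.
have rhoB : zmod_morphism (fun a : int => \pi_(int_mod d)%qT a).
  by move=> a b; rewrite raddfB.
have bdZ a f (s : {set vertex p}) :
    a * bd (top_cochain f) s = bd (top_cochain (fun m => a * f m)) s.
  rewrite /bd mulr_sumr; apply: eq_bigr => t _; rewrite top_cochainZ; ring.
have bd_dim f t : ~~ ((t \in K) && (dim t == i)) -> bd (top_cochain f) t = 0.
  apply: contraNeq => h; have : exists2 s, incidence s t != 0 & top_cochain f s != 0.
    apply/exists_inP; apply: contraNT h => /exists_inPn h.
    rewrite /bd big1 // => s _; have [->|/h] := eqVneq (incidence s t) 0.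
      by rewrite mul0r.
    by rewrite negbK => /eqP ->; rewrite mulr0.
  case=> s st fs; have sk : #|s| = k.+1.
    by apply/eqP; apply: contraNT fs => /top_cochain_out ->.
  have [ts dt] := incidence_face st; have dti : dim t = i by rewrite dt /dim sk; lia.
  have tk : (#|t| <= k)%N by have := dim_card dti; lia.
  have sY : s \in Y.
    by apply: contraNT fs => sY; rewrite top_cochain_notin.
  by rewrite dti eqxx andbT small_K // (sub_face ts).
apply: (@ker_mod_im_iso _ _ _ int (int_mod d) _ _ psi
  (fun a => \pi_(int_mod d)%qT a) psiB rhoB).
- move=> a; apply/boundary_eq0 => t.
  rewrite -(bd_bd (top_cochain (fun m => a * f0 m)) t); apply: eq_bigr => s _.
  congr (_ * _); have [sK|sK] := boolP ((s \in K) && (dim s == i)).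
    by rewrite ext_res // bdZ.
  by rewrite ext_out // bd_dim.
- by move=> t; exists (repr t); rewrite reprK.
- move=> v /boundary_eq0 v0; have [|b bY bP] := cycle_bd_small _ v0.
    by move=> s sY; rewrite ext_out //; apply: contra sY => /andP [/K_sub_Y].
  pose f m := b (top_face p m).
  have [g [gphi gj]] := recurrence_extend Phi_monic sPhi f.
  (* [g] agrees with [f] up to phi, so [h] is supported on A_0 and is a chain of [K]; [g - a * f0]
     pairs to 0 with all X^j Phi_n, hence is a cycle. *)
  pose h m := f m - g m; pose a := shift g 0.
  have hD m : (m < n)%N -> ~~ inD m -> h m = 0.
    by rewrite /h negb_or -leqNgt => _ /andP [mp _]; rewrite gphi // subrr.
  exists a, (res K (i + 1) (top_cochain h)); apply/ffunP => t; rewrite [RHS]ffunE /=.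
  rewrite (boundary_top _ _ _ hD) // ffunE bdZ.
  have gf0 : bd (top_cochain (fun m => g m - a * f0 m)) (val t) = 0.
    move: (val t); apply/(bd_top_eq0 p_prime p_inj) => j jN.
    rewrite shift_pairingB shift_pairingZ; case: j jN => [_|j jN].
      by rewrite shift_f0 mulr1 subrr.
    by rewrite gj // f0j // mulr0 subr0.
  have bdTB f1 f2 (s : {set vertex p}) : bd (top_cochain (fun m => f1 m - f2 m)) s =
     bd (top_cochain f1) s - bd (top_cochain f2) s.
    by rewrite -bdB; apply: eq_bigr => s' _; rewrite top_cochainB.
  move/eqP: gf0; rewrite bdTB subr_eq0 => /eqP <-; rewrite bdTB addrC subrK.
  have tk := simplex_small t (_ : i < k); rewrite -[LHS]ext_val -bP ?tk //; last by lia.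
  apply: eq_bigr => s _.
  have [->|/incidence_face [ts ds]] := eqVneq (incidence s (val t)) 0.
    by rewrite !mul0r.
  congr (_ * _); have sk : #|s| = k.+1.
    by have := etrans (esym ds) (dim_simplex t); rewrite /dim; lia.
  have [sY|sY] := boolP (s \in Y).
    have [m mn ->] := face_is_top p_prime p_inj sY sk.
    by rewrite (top_cochainE p_prime p_inj).
  by rewrite bY // top_cochain_notin.
- move=> a; split=> [/eqP|[u /= uE]].
    rewrite int_mod_pi_eq0 => /dvdzP [b aE].
    have [U Uu cU] := coef_row_unimodular.
    (* A Bezout vector: the first column of the inverse of [U] pairs to 1 with the first row of [U],
       so [x] pairs with c_A to b d = a. *)
    pose x := b *: row 0 (invmx U)^T.
    have xc : \sum_l x 0 l * coef_row 0 l = a.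
      have UV : \sum_l U 0 l * invmx U l 0 = 1.
        by have := mulmxV Uu => /matrixP/(_ 0 0); rewrite !mxE.
      rewrite aE -[RHS]mulr1 -UV mulr_sumr cU; apply: eq_bigr => l _.
      by rewrite !mxE; ring.
    have [f [fx fj]] := recurrence_extend Phi_monic sPhi (zero_ext x).
    have fD m : (m < n)%N -> ~~ inD m -> f m = 0.
      move=> mn mD; rewrite fx ?zero_ext_D //; move: mD; rewrite negb_or -leqNgt.
      by case/andP.
    exists (res K (i + 1) (top_cochain f)); apply/ffunP => t.
    rewrite (boundary_top _ _ _ fD) // ffunE bdZ.
    apply/eqP; rewrite -subr_eq0 -bdB.
    have -> :
        bd (fun s => top_cochain f s - top_cochain (fun m => a * f0 m) s) (val t) =
        bd (top_cochain (fun m => f m - a * f0 m)) (val t).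
      by apply: eq_bigr => s _; rewrite top_cochainB.
    apply/eqP; move: (val t); apply/(bd_top_eq0 p_prime p_inj) => j jN.
    rewrite shift_pairingB shift_pairingZ; case: j jN => [_|j jN].
      rewrite shift_f0 mulr1 -xc -shift_zero_ext.
      apply/eqP; rewrite subr_eq0; apply/eqP.
      by apply: eq_bigr => l _; rewrite addn0 fx // -ltnS.
    by rewrite fj // f0j // mulr0 subr0.
  pose f m := ext u (top_face p m).
  have fD m : (m < n)%N -> ~~ inD m -> f m = 0 by apply: ext_top.
  have bd0 (t : {set vertex p}) : bd (top_cochain (fun m => f m - a * f0 m)) t = 0.
    have [tK|/bd_dim //] := boolP ((t \in K) && (dim t == i)).
    have := congr1 (fun c : chain K i => c (Sub t tK)) uE.
    rewrite boundaryE ffunE /= bdZ => e.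
    transitivity (bd (ext u) t - bd (top_cochain (fun m => a * f0 m)) t).
      rewrite -bdB; apply: eq_bigr => s _; rewrite top_cochainB.
      by rewrite (ext_top_cochain u s ik1).
    by rewrite e subrr.
  (* [a] equals the pairing of [u] with Phi_n; among the exponents up to phi, [u] lives on A, where
     [d] divides the coefficients. *)
  have := (bd_top_eq0 p_prime p_inj _).1 bd0 0%N.
  rewrite subn_gt0 => /(_ phi_lt_n).
  rewrite shift_pairingB shift_pairingZ shift_f0 mulr1.
  move/eqP; rewrite subr_eq0 => /eqP <-; apply/eqP; rewrite int_mod_pi_eq0.
  apply: rpred_sum => l _; rewrite addn0.
  have lp : (l <= phi)%N by rewrite -ltnS.
  have [lA|lA] := boolP (inA l); last first.
    rewrite fD ?mulr0 ?dvdz0 //; first exact: leq_ltn_trans lp phi_lt_n.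
    by rewrite negb_or -leqNgt lp.
  by rewrite dvdz_mulr //; move: (nat_of_ord l) lA; apply/gcd_coefsP.
Qed.

End CyclotomicComplex.

Theorem theorem1p3 (k : nat) (p : 'I_k.+1 -> nat)
  (p_prime : forall i, prime (p i)) (p_inj : injective p)
  (A : {set 'I_(phip p).+1}) (A_neq0 : A != set0) (i : int) :
  let K := complexK A in
  let d := gcd_coefs A in
  (reduced_cohomology K i ≅
     if (i == k%:Z - 1) && (d == 0%N) then (int : zmodType)
     else if i == k%:Z then dsum (free_zmod #|A|.-1) (int_mod d)
     else free_zmod 0)
  /\
  (reduced_homology K i ≅
     if i == k%:Z - 1 then int_mod d
     else if (i == k%:Z) && (d == 0%N) then free_zmod #|A|
     else if (i == k%:Z) && (d != 0%N) then free_zmod #|A|.-1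
     else free_zmod 0).
Proof.
move=> K d.
have [ik|ik] := eqVneq i (k%:Z - 1).
  have -> : (i == k) = false by apply/negbTE/eqP; lia.
  split; last exact: homology_pred.
  case: eqVneq => [d0|d0]; first exact: cohomology_pred_eq0.
  exact: cohomology_pred_neq0.
have [ik'|ik'] /= := eqVneq i k.
  split; first exact: cohomology_top.
  case: eqVneq => [d0|d0]; first exact: homology_top_eq0.
  exact: homology_top_neq0.
have [lt|gt] : i < k%:Z - 1 \/ k%:Z < i by lia.
  by split; [apply: cohomology_low | apply: homology_low].
by split; [apply: cohomology_high | apply: homology_high].
Qed.
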